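(* Let $k$ be a field, $r\ge1$ an integer, and $B=k\langle x,y\rangle/(y^{r+1})$ with $\deg x=\deg y=1$. Every subobject of $\mathcal{O}$ in $\mathsf{QGr}\,B$ is projective.
   Context: $\mathsf{QGr}\,B:=\mathsf{Gr}\,B/\mathsf{Fdim}\,B$, where $\mathsf{Gr}\,B$ is the category of $\mathbb{Z}$-graded left $B$-modules (degree-preserving maps) and $\mathsf{Fdim}\,B$ is the Serre subcategory of modules that are unions of their finite dimensional submodules. $\mathcal{O}$ is the image of the left module $B$ in $\mathsf{QGr}\,B$. *)

(* Defs.v *)
From HB Require Import structures.
From mathcomp Require Import all_boot all_order all_algebra.
From mathcomp Require Import finmap.
From mathcomp Require Import boolp.
From mathcomp Require Import monalg.

Set Implicit Arguments.
Unset Strict Implicit.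
Unset Printing Implicit Defensive.

Import GRing.Theory.
Local Open Scope ring_scope.
Local Open Scope quotient_scope.

Record submodule (A : pzRingType) (M : lmodType A) := Submodule {
  submod_pred :> {pred M};
  submod_closedP : GRing.submod_closed submod_pred
}.

HB.instance Definition _ (A : pzRingType) (M : lmodType A) (L : submodule M) :=
  GRing.isSubmodClosed.Build A M (submod_pred L)
    (GRing.submod_closed_semi (submod_closedP L)).
HB.instance Definition _ (A : pzRingType) (M : lmodType A) (L : submodule M) :=
  GRing.isZmodClosed.Build M (submod_pred L)
    (GRing.submod_closedB (submod_closedP L)).

(* Quotient of a left module by a submodule: MathComp provides the underlying
   abelian group [Quotient.quot]; the scalar action is added here.
   The operations are locked: unification would otherwise unfold
   products and units of B down to finitely supported functions. *)
Fact lquot_key : unit. Proof. exact: tt. Qed.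

Section ModuleQuotient.
Variables (A : pzRingType) (M : lmodType A) (L : submodule M).

Definition lquot := Quotient.quot (submod_pred L).

HB.instance Definition _ := GRing.Zmodule.on lquot.
HB.instance Definition _ := EqQuotient.on lquot.

Definition lquot_proj : M -> lquot :=
  locked_with lquot_key (fun m => \pi_lquot m).

Lemma lquot_projE m : lquot_proj m = \pi_lquot m.
Proof. by rewrite /lquot_proj unlock. Qed.

Lemma lquot_projP (u v : M) : (lquot_proj u = lquot_proj v) <-> (u - v \in L).
Proof.
rewrite !lquot_projE; split => [/eqP|h].
  by rewrite -(Quotient.idealrBE (submod_pred L)).
by apply/eqP; rewrite -(Quotient.idealrBE (submod_pred L)).
Qed.

Lemma lquot_proj_eq0 (u : M) : (lquot_proj u = 0) <-> (u \in L).
Proof.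
have -> : 0 = lquot_proj 0 by rewrite lquot_projE raddf0.
by rewrite lquot_projP subr0.
Qed.

Lemma lquot_projK (q : lquot) : lquot_proj (repr q) = q.
Proof. by rewrite lquot_projE reprK. Qed.

Lemma lquot_projD u v : lquot_proj (u + v) = lquot_proj u + lquot_proj v.
Proof. by rewrite !lquot_projE raddfD. Qed.

Definition lquot_scale : A -> lquot -> lquot :=
  locked_with lquot_key (fun a q => lquot_proj (a *: repr q)).

Lemma lquot_projZ a u : lquot_scale a (lquot_proj u) = lquot_proj (a *: u).
Proof.
rewrite /lquot_scale unlock; apply/lquot_projP; rewrite -scalerBr.
apply: rpredZ; apply/lquot_projP; exact: lquot_projK.
Qed.

Lemma lquot_scaleA a b q : lquot_scale a (lquot_scale b q) = lquot_scale (a * b) q.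
Proof. by rewrite -(lquot_projK q) !lquot_projZ scalerA. Qed.
Lemma lquot_scale1 : left_id 1 lquot_scale.
Proof. by move=> q; rewrite -(lquot_projK q) lquot_projZ scale1r. Qed.
Lemma lquot_scaleDr : right_distributive lquot_scale +%R.
Proof.
move=> a p q; rewrite -(lquot_projK p) -(lquot_projK q).
by rewrite -lquot_projD !lquot_projZ -lquot_projD scalerDr.
Qed.
Lemma lquot_scaleDl q : {morph lquot_scale^~ q : a b / a + b}.
Proof. by move=> a b; rewrite -(lquot_projK q) !lquot_projZ -lquot_projD scalerDl. Qed.

HB.instance Definition _ := GRing.Zmodule_isLmodule.Build A lquot
  lquot_scaleA lquot_scale1 lquot_scaleDr lquot_scaleDl.

Lemma lquot_proj_is_linear : linear lquot_proj.
Proof. by move=> a u v; rewrite lquot_projD -lquot_projZ. Qed.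
HB.instance Definition _ := GRing.isLinear.Build A M lquot _ lquot_proj lquot_proj_is_linear.

End ModuleQuotient.

(* The free algebra k<x, y>: the monoid algebra of the free monoid on two
   letters, the letter [false] being x and the letter [true] being y. *)
Notation freeAlg k := {malg k[{fmonom bool}]}.

Section Algebra.
Variables (k : fieldType) (r : nat).

Definition freeX : freeAlg k := << fmu false >>.
Definition freeY : freeAlg k := << fmu true >>.

Definition relIdeal_pred : {pred freeAlg k} := fun p =>
  `[< exists s : seq (freeAlg k * freeAlg k),
        p = \sum_(ab <- s) ab.1 * freeY ^+ r.+1 * ab.2 >].

Lemma relIdeal_closed : GRing.submod_closed relIdeal_pred.
Proof.
split; first by apply/asboolP; exists [::]; rewrite big_nil.
move=> c p q /asboolP [s ->] /asboolP [t ->]; apply/asboolP.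
exists ([seq (c *: ab.1, ab.2) | ab <- s] ++ t).
rewrite big_cat big_map /= scaler_sumr; congr (_ + _).
by apply: eq_bigr => ab _; rewrite -!scalerAl.
Qed.

Definition relIdeal := Submodule relIdeal_closed.

Lemma relIdealMl (a p : freeAlg k) : p \in relIdeal -> a * p \in relIdeal.
Proof.
move=> /asboolP [s ->]; apply/asboolP; exists [seq (a * ab.1, ab.2) | ab <- s].
by rewrite mulr_sumr big_map; apply: eq_bigr => ab _; rewrite !mulrA.
Qed.

Lemma relIdealMr (a p : freeAlg k) : p \in relIdeal -> p * a \in relIdeal.
Proof.
move=> /asboolP [s ->]; apply/asboolP; exists [seq (ab.1, ab.2 * a) | ab <- s].
rewrite mulr_suml big_map; apply: eq_bigr => ab _.
exact: esym (mulrA _ _ _).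
Qed.

Lemma relIdeal_mcoeff1 (p : freeAlg k) : p \in relIdeal -> p@_mone = 0.
Proof.
move=> /asboolP [s ->]; rewrite raddf_sum big1 // => ab _ /=.
rewrite !rmorphM rmorphXn /= mcoeffU1.
have -> : (fmu true == mone :> {fmonom bool}) = false by rewrite fm1_eq1.
by rewrite expr0n mulr0 mul0r.
Qed.

Definition B := lquot relIdeal.
HB.instance Definition _ := GRing.Lmodule.on B.
Definition toB : freeAlg k -> B := @lquot_proj _ _ relIdeal.
HB.instance Definition _ := GRing.Linear.on toB.

Definition B_one : B := toB 1.
Fact B_mul_key : unit. Proof. exact: tt. Qed.
Definition B_mul : B -> B -> B :=
  locked_with B_mul_key (fun a b => toB (repr a * repr b)).

Lemma toBP p q : (toB p = toB q) <-> (p - q \in relIdeal).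
Proof. exact: lquot_projP. Qed.
Lemma toBK (b : B) : toB (repr b) = b.
Proof. exact: lquot_projK. Qed.

Lemma toB_mul p q : B_mul (toB p) (toB q) = toB (p * q).
Proof.
rewrite /B_mul unlock; apply/toBP; set p' := repr _; set q' := repr _.
have -> : p' * q' - p * q = (p' - p) * q' + p * (q' - q).
  by rewrite mulrBl mulrBr addrA subrK.
apply: rpredD; [apply: relIdealMr | apply: relIdealMl];
  by apply/toBP; rewrite toBK.
Qed.

Lemma B_mulA : associative B_mul.
Proof. by move=> a b c; rewrite -(toBK a) -(toBK b) -(toBK c) !toB_mul mulrA. Qed.
Lemma B_mul1 : left_id B_one B_mul.
Proof. by move=> a; rewrite -(toBK a) toB_mul mul1r. Qed.
Lemma B_mulr1 : right_id B_one B_mul.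
Proof. by move=> a; rewrite -(toBK a) toB_mul mulr1. Qed.
Lemma B_mulDl : left_distributive B_mul +%R.
Proof.
move=> a b c; rewrite -(toBK a) -(toBK b) -(toBK c) -raddfD !toB_mul.
by rewrite mulrDl raddfD.
Qed.
Lemma B_mulDr : right_distributive B_mul +%R.
Proof.
move=> a b c; rewrite -(toBK a) -(toBK b) -(toBK c) -raddfD !toB_mul.
by rewrite mulrDr raddfD.
Qed.
Lemma B_one_neq0 : B_one != 0.
Proof.
apply/eqP => /lquot_proj_eq0/relIdeal_mcoeff1/eqP.
by rewrite mcoeff1 eqxx oner_eq0.
Qed.

HB.instance Definition _ := GRing.Zmodule_isNzRing.Build B
  B_mulA B_mul1 B_mulr1 B_mulDl B_mulDr B_one_neq0.

Lemma toB_is_monoid_morphism : monoid_morphism toB.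
Proof. by split=> [|p q]; [exact: erefl | rewrite -toB_mul]. Qed.
HB.instance Definition _ :=
  GRing.isMonoidMorphism.Build (freeAlg k) B toB toB_is_monoid_morphism.

Lemma toBM (p q : freeAlg k) : toB (p * q) = toB p * toB q.
Proof. exact: rmorphM. Qed.
Lemma toBZ (c : k) (p : freeAlg k) : toB (c *: p) = c *: toB p.
Proof. exact: linearZ. Qed.

Lemma freeAlg_scalerAr (c : k) (p q : freeAlg k) : c *: (p * q) = p * (c *: q).
Proof.
have h (d : k) : d%:MP * p = p * d%:MP.
  apply/malgP => w; rewrite !malgM_def fgmulUg fgmulgU; congr mcoeff.
  by apply: eq_bigr => v _; rewrite mul1m mulm1 mulrC.
by rewrite -!mul_malgC !mulrA h.
Qed.

Lemma B_scalerAl (c : k) (a b : B) : c *: (a * b) = (c *: a) * b.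
Proof.
by rewrite -(toBK a) -(toBK b) -toBM -!toBZ -toBM scalerAl.
Qed.
HB.instance Definition _ := GRing.Lmodule_isLalgebra.Build k B B_scalerAl.

Lemma B_scalerAr (c : k) (a b : B) : c *: (a * b) = a * (c *: b).
Proof.
by rewrite -(toBK a) -(toBK b) -toBM -!toBZ -toBM freeAlg_scalerAr.
Qed.
HB.instance Definition _ := GRing.Lalgebra_isAlgebra.Build k B B_scalerAr.

End Algebra.

(* [D n] is the component of degree n of an internal direct sum decomposition
   of M indexed by the integers. *)
Record grading (M : zmodType) (D : int -> M -> Prop) : Prop := Grading {
  grading0 : forall n, D n 0;
  gradingB : forall n u v, D n u -> D n v -> D n (u - v);
  grading_dec : forall m, exists (s : seq int) (f : int -> M),
    [/\ uniq s, forall n, D n (f n) & m = \sum_(n <- s) f n];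
  grading_indep : forall (s : seq int) (f : int -> M), uniq s ->
    (forall n, D n (f n)) -> \sum_(n <- s) f n = 0 ->
    forall n, n \in s -> f n = 0
}.

Section GradingTheory.
Variables (M : zmodType) (D : int -> M -> Prop) (gD : grading D).

Lemma gradingN n u : D n u -> D n (- u).
Proof. by move=> Du; rewrite -[- u]add0r; apply: gradingB => //; apply: grading0. Qed.
Lemma gradingD n u v : D n u -> D n v -> D n (u + v).
Proof. by move=> Du Dv; rewrite -[v]opprK; apply: gradingB => //; apply: gradingN. Qed.

Lemma grading_ex (m : M) : exists f : int -> M, (forall n, D n (f n)) /\
  exists s : seq int, [/\ uniq s, forall n, n \notin s -> f n = 0
                       & m = \sum_(n <- s) f n].
Proof.
have [s [f [us Df ->]]] := grading_dec gD m.
exists (fun n => if n \in s then f n else 0); split.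
  by move=> n; case: ifP => // _; apply: grading0.
exists s; split=> // [n /negbTE -> //|].
by rewrite big_seq [RHS]big_seq; apply: eq_bigr => i ->.
Qed.

(* The homogeneous component of degree n of m. *)
Definition gcomp (m : M) (n : int) : M := sval (cid (grading_ex m)) n.

Lemma gcomp_deg m n : D n (gcomp m n).
Proof. by rewrite /gcomp; case: cid => f []. Qed.

Lemma gcomp_sum m : exists s : seq int, [/\ uniq s,
  forall n, n \notin s -> gcomp m n = 0 & m = \sum_(n <- s) gcomp m n].
Proof. by rewrite /gcomp; case: cid => f []. Qed.

Lemma big_supp (s t : seq int) (f : int -> M) : uniq s -> uniq t ->
  {subset s <= t} -> (forall n, n \notin s -> f n = 0) ->
  \sum_(n <- t) f n = \sum_(n <- s) f n.
Proof.
move=> us ut st f0; rewrite (bigID (mem s)) /= [X in _ + X]big1 ?addr0; last first.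
  by move=> n; apply: f0.
rewrite -big_filter; apply: perm_big; apply: uniq_perm => //.
  exact: filter_uniq.
by move=> n; rewrite mem_filter; case: (boolP (n \in s)) => //= /st ->.
Qed.

Lemma gcompE m (s : seq int) (f : int -> M) : uniq s -> (forall n, D n (f n)) ->
  (forall n, n \notin s -> f n = 0) -> m = \sum_(n <- s) f n -> gcomp m =1 f.
Proof.
move=> us Df f0 em n; have [t [ut g0 em']] := gcomp_sum m.
pose u := undup (s ++ t).
have uu : uniq u by apply: undup_uniq.
have h : \sum_(n <- u) (gcomp m n - f n) = 0.
  rewrite sumrB (big_supp (s:=t)) // -?em'; last first.
    by move=> i it; rewrite mem_undup mem_cat it orbT.
  rewrite (big_supp (s:=s)) // -?em ?subrr //.
  by move=> i it; rewrite mem_undup mem_cat it.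
case: (boolP (n \in u)) => [nu|].
  apply/eqP; rewrite -subr_eq0; apply/eqP.
  apply: (grading_indep gD uu _ h nu) => i.
  by apply: gradingB => //; apply: gcomp_deg.
by rewrite mem_undup mem_cat negb_or => /andP [/f0 -> /g0 ->].
Qed.

Lemma gcompD u v n : gcomp (u + v) n = gcomp u n + gcomp v n.
Proof.
have [s [us s0 eu]] := gcomp_sum u; have [t [ut t0 ev]] := gcomp_sum v.
move: n; apply: (gcompE (s:=undup (s ++ t))); first exact: undup_uniq.
- by move=> n; apply: gradingD; apply: gcomp_deg.
- by move=> n; rewrite mem_undup mem_cat negb_or => /andP [/s0 -> /t0 ->]; rewrite addr0.
rewrite big_split /= {1}eu {1}ev; congr (_ + _); apply/esym/big_supp => //;
  by [exact: undup_uniq | move=> i; rewrite mem_undup mem_cat => ->; rewrite ?orbT].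
Qed.

Lemma gcomp_homog m i n : D i m -> gcomp m n = if n == i then m else 0.
Proof.
move=> Dm; move: n; apply: (gcompE (s:=[:: i])) => //=.
- by move=> n; case: eqP => [-> //|_]; apply: grading0.
- by move=> n; rewrite inE => /negbTE ->.
by rewrite big_seq1 eqxx.
Qed.

Lemma gcomp0 n : gcomp 0 n = 0.
Proof. by rewrite (gcomp_homog n (grading0 gD 0)); case: ifP. Qed.

Lemma gcompN u n : gcomp (- u) n = - gcomp u n.
Proof. by apply/eqP; rewrite -addr_eq0 -gcompD addNr gcomp0. Qed.

Lemma gcompB u v n : gcomp (u - v) n = gcomp u n - gcomp v n.
Proof. by rewrite gcompD gcompN. Qed.

Lemma gcomp_suml (I : Type) (s : seq I) (F : I -> M) n :
  gcomp (\sum_(i <- s) F i) n = \sum_(i <- s) gcomp (F i) n.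
Proof.
by elim: s => [|i s IH]; rewrite ?big_nil ?gcomp0 // !big_cons gcompD IH.
Qed.

End GradingTheory.

Section AlgebraGrading.
Variables (k : fieldType) (r : nat).

(* The grading with deg x = deg y = 1: B_n is the image of the span of the words
   of length n. *)
Definition B_deg (n : int) (b : B k r) : Prop := exists p : freeAlg k,
  b = toB r p /\ forall w, w \in msupp p -> (size w)%:Z = n.

Definition freeComp (n : int) (p : freeAlg k) : freeAlg k :=
  \sum_(w <- msupp p | (size w)%:Z == n) << p@_w *g w >>.

Lemma freeComp_coef n p w :
  (freeComp n p)@_w = if (size w)%:Z == n then p@_w else 0.
Proof.
rewrite /freeComp raddf_sum /=.
case: (boolP (w \in msupp p)) => wp.
  rewrite (big_rem w wp) /= [X in _ + X]big1_seq.
    by case: ifP => _; rewrite ?addr0 // mcoeffUU.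
  move=> v /andP [_]; rewrite mem_rem_uniq ?fset_uniq // inE => /andP [vw _].
  by rewrite mcoeffU (negbTE vw).
rewrite big1_seq ?(mcoeff_outdom wp) ?if_same // => v /andP [_ vp].
rewrite mcoeffU; case: eqP => // e; by rewrite -e vp in wp.
Qed.

Lemma freeCompD n p q : freeComp n (p + q) = freeComp n p + freeComp n q.
Proof.
apply/malgP => w; rewrite freeComp_coef mcoeffD [RHS]mcoeffD 2!freeComp_coef.
by case: (_ == n); last exact: esym (addr0 0).
Qed.

Lemma freeComp0 n : freeComp n 0 = 0.
Proof. by apply/malgP => w; rewrite freeComp_coef mcoeff0 if_same. Qed.

Lemma freeComp_sum n (I : Type) (s : seq I) (F : I -> freeAlg k) :
  freeComp n (\sum_(i <- s) F i) = \sum_(i <- s) freeComp n (F i).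
Proof.
by elim: s => [|i s IH]; rewrite ?big_nil ?freeComp0 // !big_cons freeCompD IH.
Qed.

Lemma freeComp_mono n c w :
  freeComp n << c *g w >> = if (size w)%:Z == n then << c *g w >> else 0.
Proof.
apply/malgP => v; rewrite freeComp_coef mcoeffU; case: (eqVneq w v) => [<-|vw].
  by case: ifP; rewrite ?mcoeffUU ?mcoeff0.
by rewrite if_same; case: ifP; rewrite ?mcoeff0 // mcoeffU (negbTE vw).
Qed.

Lemma freeComp_homog n (p : freeAlg k) :
  (forall w, w \in msupp p -> (size w)%:Z = n) -> forall m,
  freeComp m p = if m == n then p else 0.
Proof.
move=> hp m; apply/malgP => w; rewrite freeComp_coef.
case: (boolP (w \in msupp p)) => [wp|/mcoeff_outdom w0].
  by rewrite (hp _ wp) eq_sym; case: ifP; rewrite ?mcoeff0.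
by rewrite w0 if_same; case: ifP; rewrite ?mcoeff0.
Qed.

Lemma freeY_exp n : exists w, freeY k ^+ n = << w >>.
Proof.
elim: n => [|n [w IH]]; first by exists mone; rewrite expr0.
by exists (mmul (fmu true) w); rewrite exprS IH malgM_def fgmulUU mulr1.
Qed.

Lemma mul3_sum (R : pzRingType) (I J : Type) (s : seq I) (t : seq J)
    (F : I -> R) (G : J -> R) (c : R) :
  (\sum_(i <- s) F i) * c * (\sum_(j <- t) G j) =
  \sum_(i <- s) \sum_(j <- t) F i * c * G j.
Proof.
by rewrite !mulr_suml; apply: eq_bigr => i _; rewrite mulr_sumr.
Qed.

Lemma freeComp_relIdeal n (p : freeAlg k) :
  p \in relIdeal k r -> freeComp n p \in relIdeal k r.
Proof.
move=> /asboolP [s ->]; rewrite freeComp_sum; apply: rpred_sum => -[a b] _.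
rewrite -[_ \in _]/(freeComp n (a * freeY k ^+ r.+1 * b) \in relIdeal k r).
have relY : freeY k ^+ r.+1 \in relIdeal k r.
  by apply/asboolP; exists [:: (1, 1)]; rewrite big_seq1 mul1r mulr1.
have [y ey] := freeY_exp r.+1.
rewrite {1}(monalgE a) {1}(monalgE b) mul3_sum freeComp_sum.
apply: rpred_sum => u _; rewrite freeComp_sum; apply: rpred_sum => v _.
have h : << a@_u *g u >> * freeY k ^+ r.+1 * << b@_v *g v >> \in relIdeal k r.
  by apply: relIdealMr; apply: relIdealMl.
move: h; rewrite ey !malgM_def !fgmulUU freeComp_mono.
by case: ifP => // _ _; apply: rpred0.
Qed.

Lemma B_grading : grading B_deg.
Proof.
split.
- by move=> n; exists 0; split; [rewrite raddf0 | move=> w; rewrite msupp0 in_fset0].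
- move=> n u v [p [-> hp]] [q [-> hq]]; exists (p - q); split.
    by rewrite raddfB.
  move=> w /(fsubsetP (msuppB_le _ _)); rewrite in_fsetU => /orP [/hp|/hq] //.
- move=> b; pose p : freeAlg k := repr b.
  pose s := undup [seq (size (fmonom_val w))%:Z | w <- enum_fset (msupp p)].
  exists s, (fun n => toB r (freeComp n p)); split.
  + exact: undup_uniq.
  + move=> n; exists (freeComp n p); split=> // w.
    rewrite -mcoeff_neq0 freeComp_coef; case: ifP => [/eqP //|]; by rewrite eqxx.
  rewrite -raddf_sum -[LHS]toBK; congr toB; apply/malgP => w.
  rewrite raddf_sum /=; under eq_bigr do rewrite freeComp_coef.
  rewrite -big_mkcond /=; case: (boolP (w \in msupp p)) => wp.
    have sw : (size w)%:Z \in s by rewrite mem_undup map_f.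
    rewrite (big_rem _ sw) /= eqxx big1_seq ?addr0 // => i /andP [/eqP <-].
    by rewrite mem_rem_uniq ?undup_uniq // inE eqxx.
  by rewrite (mcoeff_outdom wp) big1 // mcoeff_outdom.
- move=> s f us hf; have [p hp] := choice hf.
  have -> : f = fun n => toB r (p n) by apply/funext => n; case: (hp n).
  rewrite -raddf_sum => /lquot_proj_eq0 hs n ns; apply/lquot_proj_eq0.
  have := freeComp_relIdeal n hs; rewrite freeComp_sum (big_rem n ns) /=.
  rewrite (freeComp_homog (hp n).2) eqxx big1_seq ?addr0 // => i /andP [_].
  rewrite mem_rem_uniq // inE => /andP [ni _].
  by rewrite (freeComp_homog (hp i).2) eq_sym (negbTE ni).
Qed.

Lemma B_degM i j a b : B_deg i a -> B_deg j b -> B_deg (i + j) (a * b).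
Proof.
move=> [p [-> hp]] [q [-> hq]]; exists (p * q); split; first by rewrite toBM.
move=> w /msuppM_le [u [v [/hp <- /hq <- ->]]].
by rewrite -PoszD -size_cat fmM.
Qed.

End AlgebraGrading.

Section GradedModules.
Variables (k : fieldType) (r : nat).
Notation B := (B k r).

Record grMod := GrMod {
  gm_mod :> lmodType B;
  gm_deg : int -> gm_mod -> Prop;
  gm_grading : grading gm_deg;
  gm_degZ : forall i n (b : B) m, B_deg i b -> gm_deg n m -> gm_deg (i + n) (b *: m)
}.

Definition cpt (M : grMod) (m : M) (n : int) : M := gcomp (gm_grading M) m n.

Record grHom (M N : grMod) := GrHom {
  gh_fun :> {linear M -> N};
  gh_deg : forall n m, gm_deg n m -> gm_deg n (gh_fun m)
}.

(* Graded submodules: submodules containing the homogeneous components of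
   their elements. *)
Record grSub (M : grMod) := GrSub {
  gs_sub :> submodule M;
  gs_homog : forall m, m \in gs_sub -> forall n, cpt m n \in gs_sub
}.

Section SubQuot.
Variables (M : grMod) (L : grSub M).

Record subMod := SubOf { sub_val : M; sub_valP : sub_val \in submod_pred L }.
HB.instance Definition _ := [isSub for sub_val].
HB.instance Definition _ := [Choice of subMod by <:].
HB.instance Definition _ := [SubChoice_isSubLmodule of subMod by <:].

Definition sub_deg n (x : subMod) := gm_deg n (sub_val x).

Lemma sub_val_sum (I : Type) (s : seq I) (F : I -> subMod) :
  sub_val (\sum_(i <- s) F i) = \sum_(i <- s) sub_val (F i).
Proof. exact: (raddf_sum (val : subMod -> M)). Qed.

Lemma sub_valZ (b : B) (x : subMod) : sub_val (b *: x) = b *: sub_val x.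
Proof. exact: erefl. Qed.

Lemma sub_grading : grading sub_deg.
Proof.
split.
- by move=> n; apply: grading0 (gm_grading M) n.
- by move=> n u v; apply: gradingB (gm_grading M) n _ _.
- move=> m; have [s [us s0 em]] := gcomp_sum (gm_grading M) (sub_val m).
  exists s, (fun n => SubOf (gs_homog (sub_valP m) n)); split=> //.
    by move=> n; apply: gcomp_deg.
  by apply: val_inj; rewrite /= sub_val_sum.
- move=> s f us hf /(congr1 sub_val); rewrite sub_val_sum => h n ns.
  by apply: val_inj; apply: (grading_indep (gm_grading M) us _ h).
Qed.

Lemma sub_degZ i n (b : B) m : B_deg i b -> sub_deg n m -> sub_deg (i + n) (b *: m).
Proof. exact: gm_degZ. Qed.

Definition gr_sub : grMod := GrMod sub_grading sub_degZ.

Definition quot_deg n (q : lquot L) := exists m : M, gm_deg n m /\ q = lquot_proj L m.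

Lemma quot_grading : grading quot_deg.
Proof.

split.
- move=> n; exists 0; split; first exact: grading0 (gm_grading M) n.
  by rewrite raddf0.
- move=> n _ _ [u [Du ->]] [v [Dv ->]]; exists (u - v); split.
    exact: gradingB (gm_grading M) _ _ _ Du Dv.
  by rewrite raddfB.
- move=> q; have [s [us s0 em]] := gcomp_sum (gm_grading M) (repr q).
  exists s, (fun n => lquot_proj L (gcomp (gm_grading M) (repr q) n)); split=> //.
    by move=> n; exists (gcomp (gm_grading M) (repr q) n); split=> //; apply: gcomp_deg.
  by rewrite -raddf_sum -em; apply/esym/lquot_projK.
- move=> s f us hf; have [g hg] := choice hf.
  have -> : f = fun n => lquot_proj L (g n) by apply/funext => n; case: (hg n).
  rewrite -raddf_sum => /lquot_proj_eq0 h n ns; apply/lquot_proj_eq0.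
  have := gs_homog h n; rewrite /cpt gcomp_suml (big_rem n ns) /=.
  rewrite (gcomp_homog (gm_grading M) _ (hg n).1) eqxx big1_seq ?addr0 // => i /andP [_].
  rewrite mem_rem_uniq // inE => /andP [ni _].
  by rewrite (gcomp_homog (gm_grading M) _ (hg i).1) eq_sym (negbTE ni).
Qed.

Lemma quot_degZ i n (b : B) m : B_deg i b -> quot_deg n m -> quot_deg (i + n) (b *: m).
Proof.
move=> Db [u [Du ->]]; exists (b *: u); split; first exact: gm_degZ.
by rewrite linearZ.
Qed.

Definition gr_quot : grMod := GrMod quot_grading quot_degZ.

End SubQuot.

(* k acts on a B-module through k -> B. *)
Definition finDim (M : lmodType B) : Prop := exists s : seq M,
  forall m, exists c : nat -> k, m = \sum_(i < size s) (c i)%:A *: s`_i.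

(* The objects of Fdim B: unions of finite dimensional graded submodules. *)
Definition Fdim (M : grMod) : Prop :=
  forall m : M, exists L : grSub M, m \in gs_sub L /\ finDim (gr_sub L).

Definition regMod : grMod :=
  @GrMod (GRing.regular B) (@B_deg k r) (@B_grading k r) (@B_degM k r).

(* Fdim amounts to the annihilation of every element by all sufficiently long
   words: see [Fdim_evk] and [evk_Fdim]. *)
Definition word (w : seq bool) : B := toB r << FMonom w >>.

Lemma word_cat u v : word (u ++ v) = word u * word v.
Proof.
rewrite /word -toBM malgM_def fgmulUU mulr1; congr (toB r << _ >>).
by apply: val_inj; rewrite /= fmM.
Qed.

Lemma word_nil : word [::] = 1.
Proof.
rewrite /word (_ : FMonom [::] = mone); first by rewrite -[RHS](rmorph1 (toB r)).
by apply: val_inj; rewrite /= fm1.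
Qed.

Lemma word_deg w : B_deg (size w)%:Z (word w).
Proof.
exists << FMonom w >>; split=> // v.
by rewrite msuppU1 in_fset1 => /eqP ->.
Qed.

Lemma B_span (b : B) : exists (s : seq (seq bool)) (c : seq bool -> k),
  b = \sum_(w <- s) (c w)%:A * word w.
Proof.
pose p : freeAlg k := repr b.
exists [seq fmonom_val w | w <- enum_fset (msupp p)], (fun w => p@_(FMonom w)).
rewrite big_map -[LHS]toBK -/p {1}(monalgE p) raddf_sum.
apply: eq_bigr => w _; rewrite -scalerAl mul1r /word fmK -toBZ.
congr toB; apply/malgP => v.
rewrite [RHS]mcoeffZ 2!mcoeffU; case: (w == v); first by rewrite !mulr1n mulr1.
by rewrite !mulr0n mulr0.
Qed.

Lemma algA_deg (c : k) : @B_deg k r 0 c%:A.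
Proof.
exists (c *: << FMonom [::] >>); split.
  by rewrite toBZ -/(word [::]) word_nil.
by move=> w /(fsubsetP (msuppZ_le _ _)); rewrite msuppU1 in_fset1 => /eqP ->.
Qed.

Lemma algA_comm (M : lmodType B) (c : k) (b : B) (m : M) :
  b *: (c%:A *: m) = c%:A *: (b *: m).
Proof. by rewrite !scalerA -scalerAr mulr1 -scalerAl mul1r. Qed.

Lemma cptZ (M : grMod) i (b : B) (m : M) n :
  B_deg i b -> cpt (b *: m) (i + n) = b *: cpt m n.
Proof.
move=> Db; have [s [us s0 em]] := gcomp_sum (gm_grading M) m.
have E : cpt (b *: m) =1 (fun t => b *: cpt m (t - i)); last first.
  by rewrite E addrAC subrr add0r.
apply: (gcompE (gm_grading M) (s := [seq i + j | j <- s])).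
- by rewrite map_inj_uniq; [exact: us | apply: addrI].
- move=> t; rewrite -[X in gm_deg X](subrK i t) addrC.
  by apply: gm_degZ; [exact: Db | apply: gcomp_deg].
- move=> t ts; rewrite /cpt s0; first by rewrite scaler0.
  apply: contra ts => ts.
  by apply/mapP; exists (t - i); [exact: ts | rewrite addrC subrK].
rewrite big_map [X in _ *: X]em scaler_sumr; apply: eq_bigr => j _.
by rewrite /cpt addrAC subrr add0r.
Qed.

Lemma cptZk (M : grMod) (c : k) (m : M) n : cpt (c%:A *: m) n = c%:A *: cpt m n.
Proof. by rewrite -{1}[n]add0r cptZ //; apply: algA_deg. Qed.

Lemma cpt_eq0 (M : grMod) (m : M) : (forall n, cpt m n = 0) -> m = 0.
Proof.
move=> h; have [s [_ _ ->]] := gcomp_sum (gm_grading M) m.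
by rewrite big1 // => i _; apply: h.
Qed.

Lemma cpt_bound (M : grMod) (m : M) :
  exists N : nat, forall i : int, (N < absz i)%N -> cpt m i = 0.
Proof.
have [s [_ s0 _]] := gcomp_sum (gm_grading M) m.
exists (\max_(i <- s) absz i)%N => i hi; apply: s0; apply: contraL hi => si.
by rewrite -leqNgt; exact: (leq_bigmax_seq i si isT).
Qed.

Lemma cpt_bound_seq (M : grMod) (s : seq M) :
  exists N : nat, forall m, m \in s -> forall i : int, (N < absz i)%N -> cpt m i = 0.
Proof.
elim: s => [|m s [N IH]]; first by exists 0%N.
have [N' h] := cpt_bound m; exists (maxn N N') => m'; rewrite inE => mm' i.
rewrite gtn_max => /andP [h1 h2].
by case/orP: mm' => [/eqP -> | ms]; [apply: h | apply: IH].
Qed.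

Definition spanned (M : lmodType B) (t : seq M) (m : M) : Prop :=
  exists c : nat -> k, m = \sum_(i < size t) (c i)%:A *: t`_i.

Lemma spanned_mem (M : lmodType B) (t : seq M) x : x \in t -> spanned t x.
Proof.
move=> xt; exists (fun i => (i == index x t)%:R).
have ht : (index x t < size t)%N by rewrite index_mem.
rewrite (bigD1 (Ordinal ht)) //= eqxx scale1r scale1r nth_index //.
rewrite big1 ?addr0 // => i; rewrite -val_eqE /= => /negbTE ->.
by rewrite scale0r scale0r.
Qed.

Lemma spannedD (M : lmodType B) (t : seq M) x y :
  spanned t x -> spanned t y -> spanned t (x + y).
Proof.
move=> [c ->] [d ->]; exists (fun i => c i + d i).
by rewrite -big_split /=; apply: eq_bigr => i _; rewrite scalerDl scalerDl.
Qed.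

Lemma spannedZ (M : lmodType B) (t : seq M) (c : k) x :
  spanned t x -> spanned t (c%:A *: x).
Proof.
move=> [d ->]; exists (fun i => c * d i); rewrite scaler_sumr.
by apply: eq_bigr => i _; rewrite scalerA -scalerAl mul1r scalerA.
Qed.

Lemma spanned0 (M : lmodType B) (t : seq M) : spanned t 0.
Proof. by exists (fun=> 0); rewrite big1 // => i _; rewrite !scale0r. Qed.

Lemma spanned_sum (M : lmodType B) (t : seq M) (I : Type) (s : seq I) (F : I -> M) :
  (forall i, spanned t (F i)) -> spanned t (\sum_(i <- s) F i).
Proof.
move=> h; elim: s => [|i s IH]; first by rewrite big_nil; apply: spanned0.
by rewrite big_cons; apply: spannedD.
Qed.

Definition evk (M : lmodType B) (P : M -> Prop) (m : M) : Prop :=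
  exists n : nat, forall w, (n <= size w)%N -> P (word w *: m).

Lemma evk_and (M : lmodType B) (P Q : M -> Prop) m :
  evk P m -> evk Q m -> evk (fun x => P x /\ Q x) m.
Proof.
move=> [n hn] [p hp]; exists (maxn n p) => w; rewrite geq_max => /andP [h1 h2].
by split; [apply: hn | apply: hp].
Qed.

Lemma evk_imp (M : lmodType B) (P Q : M -> Prop) m :
  (forall x, P x -> Q x) -> evk P m -> evk Q m.
Proof. by move=> h [n hn]; exists n => w /hn /h. Qed.

Lemma evk_trans (M : lmodType B) (P Q : M -> Prop) m :
  evk P m -> (forall x, P x -> evk Q x) -> evk Q m.
Proof.
move=> [n hn] hPQ.
have /choice [b hb] : forall t : n.-tuple bool, exists b : nat,
    forall v, (b <= size v)%N -> Q (word v *: (word t *: m)).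
  by move=> t; apply: hPQ; apply: hn; rewrite size_tuple.
exists (n + \max_t b t)%N => w hw.
have nw : (n <= size w)%N by apply: leq_trans hw; apply: leq_addr.
have sz : size (drop (size w - n) w) == n by rewrite size_drop subKn.
rewrite -(cat_take_drop (size w - n) w) word_cat -scalerA.
apply: (hb (Tuple sz)); apply: leq_trans (leq_bigmax (Tuple sz)) _.
by rewrite size_takel ?leq_subr // leq_subRL.
Qed.

Lemma Fdim_evk (M : grMod) : Fdim M -> forall m : M, evk (fun x => x = 0) m.
Proof.
move=> hM m; have [L [mL [s hs]]] := hM m.
have [N hN] := cpt_bound_seq [seq sub_val x | x <- s].
have [N' hN'] := cpt_bound m.
have LN (l : M) i : l \in gs_sub L -> (N < absz i)%N -> cpt l i = 0.
  move=> lL Ni; have [c] := hs (SubOf lL); move/(congr1 (@sub_val _ _)).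
  rewrite sub_val_sum -[sub_val (SubOf lL)]/l => ->; rewrite /cpt gcomp_suml big1 // => j _.
  rewrite sub_valZ -/(cpt _ _) cptZk hN ?scaler0 //.
  by apply: map_f; apply: mem_nth.
exists (N + N').+1 => w hw; apply: cpt_eq0 => i.
have wL : word w *: m \in gs_sub L by apply: rpredZ.
case: (ltnP N (absz i)) => [|iN]; first exact: LN.
rewrite -(subrK (size w)%:Z i) addrC cptZ ?hN' ?scaler0 //; last exact: word_deg.
have tri : (size w <= absz i + absz (i - (size w)%:Z))%N.
  rewrite -lez_nat PoszD !abszE; have := Num.Theory.ler_normB i (i - (size w)%:Z).
  by rewrite subKr.
by move: (leq_trans hw tri); apply: contraLR; rewrite -!leqNgt => h; apply: leq_add.
Qed.

Lemma evk_Fdim (M : grMod) : (forall m : M, evk (fun x => x = 0) m) -> Fdim M.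
Proof.
move=> hM m; have [n hn] := hM m.
have [s [us s0 em]] := gcomp_sum (gm_grading M) m.
have hcpt i w : (n <= size w)%N -> word w *: cpt m i = 0.
  by move=> nw; rewrite -(cptZ _ _ (word_deg w)) hn // /cpt gcomp0.
pose ws := flatten [seq [seq tval t | t <- enum {: j.-tuple bool}] | j <- iota 0 n].
have wsP w : (size w < n)%N -> w \in ws.
  move=> hw; apply/flattenP; exists [seq tval t | t <- enum {: (size w).-tuple bool}].
    by apply/mapP; exists (size w) => //; rewrite mem_iota.
  by apply/mapP; exists (in_tuple w); rewrite ?mem_enum.
pose t := [seq word w *: cpt m i | w <- ws, i <- s].
have tP w i : i \in s -> spanned t (word w *: cpt m i).
  move=> si; case: (ltnP (size w) n) => [/wsP hw|/hcpt ->]; last exact: spanned0.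
  by apply: spanned_mem; apply: allpairs_f.
have tB (b : B) x : x \in t -> spanned t (b *: x).
  move=> /allpairsP [[w i] [_ /= si ->]]; have [vs [c ->]] := B_span b.
  rewrite scaler_suml; apply: spanned_sum => v.
  by rewrite -scalerA; apply: spannedZ; rewrite scalerA -word_cat; apply: tP.
have Lc : GRing.submod_closed (fun x : M => `[< spanned t x >]).
  split; first by apply/asboolP/spanned0.
  move=> b x y /asboolP [c ->] /asboolP hy; apply/asboolP; apply: spannedD hy.
  rewrite scaler_sumr; apply: spanned_sum => i; rewrite algA_comm.
  by apply: spannedZ; apply: tB; apply: mem_nth.
have Lh (x : M) : x \in Submodule Lc -> forall i, cpt x i \in Submodule Lc.
  move=> /asboolP [c ->] i; apply/asboolP; rewrite /cpt gcomp_suml.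
  apply: spanned_sum => j; rewrite -/(cpt _ _) cptZk; apply: spannedZ.
  have /allpairsP [[w d] [_ /= ds ->]] : t`_j \in t by apply: mem_nth.
  rewrite /cpt (gcomp_homog (gm_grading M) (i := (size w)%:Z + d)).
    by case: ifP => _; [apply: tP | apply: spanned0].
  by apply: gm_degZ; [apply: word_deg | apply: gcomp_deg].
exists (GrSub Lh); split.
  apply/asboolP; rewrite em big_seq; elim/big_rec: _ => [|i x si IH].
    exact: spanned0.
  by apply: spannedD IH; rewrite -[gcomp _ m i]scale1r -word_nil; apply: tP.
pose lft x : subMod (GrSub Lh) := insubd 0 x.
have lftK x : x \in t -> sub_val (lft x) = x.
  by move=> xt; apply: (insubdK (sT := subMod (GrSub Lh))); apply/asboolP/spanned_mem.
exists [seq lft x | x <- t] => y; have /asboolP [c ec] := sub_valP y.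
exists c; apply: val_inj; rewrite -[LHS]/(sub_val y) -[RHS]/(sub_val _).
rewrite sub_val_sum ec size_map; apply: eq_bigr => i _.
by rewrite sub_valZ (nth_map 0) // lftK //; apply: mem_nth.
Qed.

Lemma Fdim_quotP (M : grMod) (L : grSub M) :
  Fdim (gr_quot L) <-> forall m : M, evk (fun x => x \in gs_sub L) m.
Proof.
split=> [/Fdim_evk h m|h].
  have [n hn] := h (lquot_proj (gs_sub L) m); exists n => w /hn.
  by rewrite -linearZ => /lquot_proj_eq0.
apply: evk_Fdim => q; have [n hn] := h (repr q); exists n => w /hn hw.
by rewrite -[q](lquot_projK (L := gs_sub L)) -linearZ; apply/lquot_proj_eq0.
Qed.

Lemma Fdim_subP (M : grMod) (L : grSub M) :
  Fdim (gr_sub L) <-> forall m : M, m \in gs_sub L -> evk (fun x => x = 0) m.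
Proof.
split=> [/Fdim_evk h m mL|h].
  have [n hn] := h (SubOf mL); exists n => w /hn.
  by move/(congr1 (@sub_val _ _)); rewrite sub_valZ.
apply: evk_Fdim => x; have [n hn] := h _ (sub_valP x); exists n => w /hn hw.
by apply: val_inj; rewrite -[LHS]/(sub_val _) sub_valZ.
Qed.

(* A representative of an element of the colimit of the groups
   Hom(M', N / N'), over the graded submodules M' of M and N' of N with M / M'
   and N' in Fdim B. *)
Record qHom (M N : grMod) := QHom {
  q_dom : grSub M;
  q_ind : grSub N;
  q_domP : Fdim (gr_quot q_dom);
  q_indP : Fdim (gr_sub q_ind);
  q_map : grHom (gr_sub q_dom) (gr_quot q_ind)
}.

Arguments q_domP {M N} _.
Arguments q_indP {M N} _.

(* The image of m under M' -> N / N' is defined and is the class of n. *)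
Definition q_graph (M N : grMod) (f : qHom M N) (m : M) (n : N) : Prop :=
  exists h : m \in submod_pred (q_dom f),
    q_map f (SubOf h) = lquot_proj (q_ind f) n.

(* Equality in the colimit: f and g induce the same map D -> N / E for some
   D contained in their domains and E containing their indeterminacies. *)
Definition q_eq (M N : grMod) (f g : qHom M N) : Prop :=
  exists (D : grSub M) (E : grSub N),
    [/\ Fdim (gr_quot D) /\ Fdim (gr_sub E),
        {subset D <= q_dom f} /\ {subset D <= q_dom g},
        {subset q_ind f <= E} /\ {subset q_ind g <= E}
      & forall m u v, m \in gs_sub D ->
          q_graph f m u -> q_graph g m v -> u - v \in gs_sub E].

(* The graphs of the elements of [qHom M N]. *)
Record is_qrel (M N : grMod) (R : M -> N -> Prop) : Prop := IsQrel {
  qrel0 : R 0 0;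
  qrelP : forall (b : B) m n m' n', R m n -> R m' n' -> R (b *: m + m') (b *: n + n');
  qrel_cpt : forall m n, R m n -> forall i, R (cpt m i) (cpt n i);
  qrel_dom : forall m, evk (fun x => exists n, R x n) m;
  qrel_ind : forall n, R 0 n -> evk (fun x => x = 0) n
}.

Section RelTheory.
Variables (M N : grMod) (R : M -> N -> Prop) (hR : is_qrel R).

Lemma qrelD m n m' n' : R m n -> R m' n' -> R (m + m') (n + n').
Proof. by move=> h h'; have := qrelP hR 1 h h'; rewrite !scale1r. Qed.
Lemma qrelZ b m n : R m n -> R (b *: m) (b *: n).
Proof. by move=> h; have := qrelP hR b h (qrel0 hR); rewrite !addr0. Qed.
Lemma qrelB m n m' n' : R m n -> R m' n' -> R (m - m') (n - n').
Proof.
by move=> h /(qrelZ (-1)) h'; have := qrelD h h'; rewrite !scaleN1r.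
Qed.
Lemma qrel_uniq m n n' : R m n -> R m n' -> R 0 (n - n').
Proof. by move=> h h'; have := qrelB h h'; rewrite subrr. Qed.

Lemma rel_dom_closed : GRing.submod_closed (fun m => `[< exists n, R m n >]).
Proof.
split; first by apply/asboolP; exists 0; apply: qrel0.
move=> b m m' /asboolP [n h] /asboolP [n' h']; apply/asboolP.
by exists (b *: n + n'); apply: qrelP.
Qed.
Lemma rel_dom_homog m : m \in Submodule rel_dom_closed ->
  forall i, cpt m i \in Submodule rel_dom_closed.
Proof.
move=> /asboolP [n h] i; apply/asboolP; exists (cpt n i); exact: qrel_cpt.
Qed.
Definition rel_dom := GrSub rel_dom_homog.

Lemma rel_ind_closed : GRing.submod_closed (fun n => `[< R 0 n >]).
Proof.
split; first by apply/asboolP; apply: qrel0.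
move=> b n n' /asboolP h /asboolP h'; apply/asboolP.
by have := qrelP hR b h h'; rewrite scaler0 addr0.
Qed.
Lemma rel_ind_homog n : n \in Submodule rel_ind_closed ->
  forall i, cpt n i \in Submodule rel_ind_closed.
Proof.
move=> /asboolP h i; apply/asboolP; have := qrel_cpt hR h i.
by rewrite {1}/cpt gcomp0.
Qed.
Definition rel_ind := GrSub rel_ind_homog.

Lemma rel_domP : Fdim (gr_quot rel_dom).
Proof.
apply/Fdim_quotP => m; apply: evk_imp (qrel_dom hR m) => x h.
by apply/asboolP.
Qed.
Lemma rel_indP : Fdim (gr_sub rel_ind).
Proof. by apply/Fdim_subP => n /asboolP; apply: qrel_ind. Qed.

Lemma rel_ex (x : gr_sub rel_dom) : exists n, R (sub_val x) n.
Proof. by have /asboolP := sub_valP x. Qed.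

Definition rel_fun (x : gr_sub rel_dom) : gr_quot rel_ind :=
  lquot_proj rel_ind (sval (cid (rel_ex x))).

Lemma rel_funE x n : R (sub_val x) n -> rel_fun x = lquot_proj rel_ind n.
Proof.
move=> h; apply/lquot_projP; case: cid => n' h' /=; apply/asboolP.
exact: qrel_uniq h' h.
Qed.

Lemma rel_fun_linear : linear rel_fun.
Proof.
move=> b x y; have [n h] := rel_ex x; have [n' h'] := rel_ex y.
rewrite (rel_funE h) (rel_funE h') -linearZ -linearD /=.
by apply: rel_funE; apply: qrelP.
Qed.
HB.instance Definition _ :=
  GRing.isLinear.Build B (gr_sub rel_dom) (gr_quot rel_ind) _ rel_fun rel_fun_linear.

Lemma rel_fun_deg i x : gm_deg i x -> gm_deg i (rel_fun x).
Proof.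
move=> Dx; have [n h] := rel_ex x; exists (cpt n i); split; first exact: gcomp_deg.
apply: rel_funE; have := qrel_cpt hR h i.
by rewrite {1}/cpt (gcomp_homog (gm_grading M) i (Dx : gm_deg i (sub_val x))) eqxx.
Qed.

Definition q_of_rel : qHom M N :=
  QHom rel_domP rel_indP (@GrHom (gr_sub rel_dom) (gr_quot rel_ind) rel_fun rel_fun_deg).

Lemma q_of_relP m n : q_graph q_of_rel m n <-> R m n.
Proof.
split=> [[h /=]|h].
  have [n' h'] := rel_ex (SubOf h); rewrite (rel_funE h').
  move/lquot_projP/asboolP => h0; have := qrelB h' h0.
  by rewrite subr0 subKr.
have hm : m \in submod_pred rel_dom by apply/asboolP; exists n.
by exists hm; apply: rel_funE.
Qed.

End RelTheory.

Lemma q_graph_ex (M N : grMod) (f : qHom M N) m :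
  m \in gs_sub (q_dom f) -> exists n, q_graph f m n.
Proof. by move=> h; exists (repr (q_map f (SubOf h))), h; rewrite lquot_projK. Qed.

Lemma q_graph_qrel (M N : grMod) (f : qHom M N) : is_qrel (q_graph f).
Proof.
have qP b m n m' n' : q_graph f m n -> q_graph f m' n' ->
    q_graph f (b *: m + m') (b *: n + n').
  move=> [h e] [h' e']; have h2 : b *: m + m' \in submod_pred (q_dom f).
    by apply: rpredD => //; apply: rpredZ.
  exists h2; rewrite linearD linearZ /= -e -e' -linearZ -linearD /=.
  by congr (q_map f _); apply: val_inj.
have q0 n : q_graph f 0 n <-> n \in gs_sub (q_ind f).
  split=> [[h]|hn].
    have -> : SubOf h = 0 by apply: val_inj.
    by rewrite linear0 => /esym/lquot_proj_eq0.
  exists (rpred0 _); have -> : SubOf (rpred0 (submod_pred (q_dom f))) = 0.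
    by apply: val_inj.
  by rewrite linear0; apply/esym/lquot_proj_eq0.
have qd m : (exists n, q_graph f m n) <-> m \in gs_sub (q_dom f).
  by split=> [[n [h _]] //|]; apply: q_graph_ex.
split=> //.
- by apply/q0; apply: rpred0.
- move=> m n [h e] i; have hi : cpt m i \in submod_pred (q_dom f).
    exact: (gs_homog h).
  exists hi.
  have comp_map (x : gr_sub (q_dom f)) j : cpt (q_map f x) j = q_map f (cpt x j).
    have [s [us s0 ex]] := gcomp_sum (gm_grading _) x.
    move: j; apply: (gcompE (gm_grading (gr_quot (q_ind f))) us).
    + by move=> j; apply: gh_deg; apply: gcomp_deg.
    + by move=> j /s0; rewrite /cpt => ->; rewrite linear0.
    by rewrite {1}ex linear_sum.
  have comp_sub (x : gr_sub (q_dom f)) j : sub_val (cpt x j) = cpt (sub_val x) j.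
    have [s [us s0 ex]] := gcomp_sum (gm_grading _) x.
    apply: esym; move: j; apply: (gcompE (gm_grading M) us).
    + by move=> j; apply: (gcomp_deg (gm_grading (gr_sub (q_dom f)))).
    + by move=> j /s0; rewrite /cpt => ->.
    by rewrite {1}ex sub_val_sum.
  have comp_quot (y : N) j : cpt (lquot_proj (q_ind f) y : gr_quot (q_ind f)) j =
      lquot_proj (q_ind f) (cpt y j).
    have [s [us s0 ey]] := gcomp_sum (gm_grading N) y.
    move: j; apply: (gcompE (gm_grading (gr_quot (q_ind f))) us).
    + by move=> j; exists (cpt y j); split=> //; apply: gcomp_deg.
    + by move=> j /s0; rewrite /cpt => ->; rewrite linear0.
    by rewrite {1}ey linear_sum.
  rewrite -comp_quot -e comp_map; congr (q_map f _); apply: val_inj.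
  by rewrite -[RHS]/(sub_val _) comp_sub.
- move=> m; have /Fdim_quotP /(_ m) h := q_domP f.
  by apply: evk_imp h => x /qd.
- by move=> n /q0; move: n; apply/Fdim_subP; apply: q_indP.
Qed.

Lemma q_eqP (M N : grMod) (f g : qHom M N) : q_eq f g <->
  forall m u v, q_graph f m u -> q_graph g m v -> evk (fun x => x = 0) (u - v).
Proof.
have gf := q_graph_qrel f; have gg := q_graph_qrel g; split.
  move=> [D [E [[/Fdim_quotP hD /Fdim_subP hE] _ _ h]]] m u v mu mv.
  apply: (evk_trans (P := fun x => x \in gs_sub E)); last exact: hE.
  apply: (evk_imp (P := fun x => x \in gs_sub E)) => //.
  have [n hn] := hD m; exists n => w /hn wD; rewrite scalerBr.
  by apply: (h (word w *: m)) => //; apply: qrelZ.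
move=> h.
pose RD (m : M) := (exists u, q_graph f m u) /\ (exists v, q_graph g m v).
have RDc : GRing.submod_closed (fun m => `[< RD m >]).
  split; first by apply/asboolP; split; exists 0; apply: qrel0.
  move=> b m m' /asboolP [[u hu] [v hv]] /asboolP [[u' hu'] [v' hv']].
  by apply/asboolP; split; [exists (b *: u + u') | exists (b *: v + v')];
    apply: qrelP.
have RDh m : m \in Submodule RDc -> forall i, cpt m i \in Submodule RDc.
  move=> /asboolP [[u hu] [v hv]] i; apply/asboolP.
  by split; [exists (cpt u i) | exists (cpt v i)]; apply: qrel_cpt.
pose tor (n : N) := evk (fun x => x = 0) n.
have torc : GRing.submod_closed (fun n => `[< tor n >]).
  split; first by apply/asboolP; exists 0%N => w _; rewrite scaler0.
  move=> b n n' /asboolP hn /asboolP hn'; apply/asboolP.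
  have torD x y : tor x -> tor y -> tor (x + y).
    move=> [p hp] [q hq]; exists (maxn p q) => w; rewrite geq_max => /andP [h1 h2].
    by rewrite scalerDr hp ?hq ?addr0.
  have torZ (c : k) x : tor x -> tor (c%:A *: x).
    by move=> [p hp]; exists p => w /hp e; rewrite algA_comm e scaler0.
  have torW v x : tor x -> tor (word v *: x).
    move=> [p hp]; exists p => w hw; rewrite scalerA -word_cat; apply: hp.
    by rewrite size_cat; apply: leq_trans hw (leq_addr _ _).
  apply: (torD) => //; have [s [c ->]] := B_span b; rewrite scaler_suml.
  apply: (big_rec tor) => [|v x _ hx]; first by exists 0%N => w _; rewrite scaler0.
  by apply: torD hx; rewrite -scalerA; apply: torZ; apply: torW.
have torh n : n \in Submodule torc -> forall i, cpt n i \in Submodule torc.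
  move=> /asboolP [p hp] i; apply/asboolP; exists p => w hw.
  by rewrite -(cptZ _ _ (word_deg w)) hp // /cpt gcomp0.
exists (GrSub RDh), (GrSub torh); split; [split | split | split |].
- apply/Fdim_quotP => m.
  have : evk (fun x => (exists u, q_graph f x u) /\ (exists v, q_graph g x v)) m.
    by apply: evk_and; apply: qrel_dom.
  by move=> h0; apply: evk_imp h0 => x hx; apply/asboolP.
- by apply/Fdim_subP => n /asboolP.
- by move=> m /asboolP [[u [hm _]] _].
- by move=> m /asboolP [_ [v [hm _]]].
- by move=> n nf; apply/asboolP; move: n nf; apply/Fdim_subP; apply: q_indP.
- by move=> n nf; apply/asboolP; move: n nf; apply/Fdim_subP; apply: q_indP.
by move=> m u v _ hu hv; apply/asboolP; apply: h hu hv.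
Qed.

Lemma q_eq_graph (M N : grMod) (f g : qHom M N) :
  (forall m n, q_graph f m n -> q_graph g m n) -> q_eq f g.
Proof.
move=> h; apply/q_eqP => m u v /h hu hv; have gg := q_graph_qrel g.
by apply: (qrel_ind gg); apply: qrel_uniq hu hv.
Qed.

Lemma q_id_qrel (M : grMod) : is_qrel (fun m n : M => m = n).
Proof.
split=> //.
- by move=> b m n m' n' -> ->.
- by move=> m n ->.
- by move=> m; exists 0%N => w _; exists (word w *: m).
- by move=> n <-; exists 0%N => w _; rewrite scaler0.
Qed.

Definition q_id (M : grMod) : qHom M M := q_of_rel (q_id_qrel M).

Lemma q_comp_qrel (M N P : grMod) (g : qHom N P) (f : qHom M N) :
  is_qrel (fun m p => exists n, q_graph f m n /\ q_graph g n p).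
Proof.
have gf := q_graph_qrel f; have gg := q_graph_qrel g; split.
- by exists 0; split; apply: qrel0.
- move=> b m p m' p' [n [h1 h2]] [n' [h1' h2']]; exists (b *: n + n').
  by split; apply: qrelP.
- by move=> m p [n [h1 h2]] i; exists (cpt n i); split; apply: qrel_cpt.
- move=> m; apply: (evk_trans (qrel_dom gf m)) => x [n hn].
  have [a ha] := qrel_dom gg n; exists a => w /ha [p hp].
  by exists p, (word w *: n); split=> //; apply: qrelZ.
- move=> p [n [h1 h2]].
  apply: (evk_trans (P := fun x => q_graph g 0 x)); last exact: qrel_ind gg.
  have [a ha] := qrel_ind gf h1; exists a => w /ha e.
  by rewrite -e; apply: qrelZ.
Qed.

(* For f : M' -> N / N' and g : N'' -> P / P', the composite is defined on the
   elements m such that f m is the class of some n in N''; it sends m to the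
   class of g n modulo P' + g(N' :&: N''). *)
Definition q_comp (M N P : grMod) (g : qHom N P) (f : qHom M N) : qHom M P :=
  q_of_rel (q_comp_qrel g f).

Lemma q_eq_refl (M N : grMod) (f : qHom M N) : q_eq f f.
Proof. exact: q_eq_graph. Qed.
Lemma q_eq_sym (M N : grMod) (f g : qHom M N) : q_eq f g -> q_eq g f.
Proof.
move=> /q_eqP h; apply/q_eqP => m u v hu hv; have [n hn] := h _ _ _ hv hu.
by exists n => w /hn; rewrite !scalerBr => /eqP; rewrite subr_eq0 => /eqP ->; rewrite subrr.
Qed.
Lemma q_eq_trans (M N : grMod) (f g h : qHom M N) : q_eq f g -> q_eq g h -> q_eq f h.
Proof.
move=> /q_eqP fg /q_eqP gh; apply/q_eqP => m u v hu hv.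
have gf := q_graph_qrel f; have gg := q_graph_qrel g; have gg' := q_graph_qrel h.
apply: (evk_trans (P := fun x => evk (fun x => x = 0) x)) => //.
have [a ha] := qrel_dom gg m; exists a => w /ha [x hx].
have [p hp] := fg _ _ _ (qrelZ gf (word w) hu) hx.
have [q hq] := gh _ _ _ hx (qrelZ gg' (word w) hv).
exists (maxn p q) => t; rewrite geq_max => /andP [h1 h2].
rewrite scalerBr -(subrK x (word w *: u)) -addrA scalerDr.
by rewrite hp // hq // addr0.
Qed.

Lemma q_comp_eq (M N P : grMod) (g g' : qHom N P) (f f' : qHom M N) :
  q_eq g g' -> q_eq f f' -> q_eq (q_comp g f) (q_comp g' f').
Proof.
move=> /q_eqP hg /q_eqP hf; apply/q_eqP => m u v /q_of_relP [n [h1 h2]].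
move=> /q_of_relP [n' [h1' h2']].
have gg := q_graph_qrel g; have gg' := q_graph_qrel g'.
apply: (evk_trans (P := fun x => evk (fun x => x = 0) x)) => //.
have [a ha] := hf _ _ _ h1 h1'; exists a => w /ha.
rewrite scalerBr => /eqP; rewrite subr_eq0 => /eqP e; rewrite scalerBr.
apply: hg (qrelZ gg (word w) h2) _; rewrite e; exact: qrelZ.
Qed.

Lemma q_comp1 (M N : grMod) (f : qHom M N) : q_eq (q_comp f (q_id M)) f.
Proof. by apply: q_eq_graph => m n /q_of_relP [x [/q_of_relP <-]]. Qed.
Lemma q_1comp (M N : grMod) (f : qHom M N) : q_eq (q_comp (q_id N) f) f.
Proof. by apply: q_eq_graph => m n /q_of_relP [x [h /q_of_relP <-]]. Qed.
Lemma q_compA (M N P Q : grMod) (h : qHom P Q) (g : qHom N P) (f : qHom M N) :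
  q_eq (q_comp h (q_comp g f)) (q_comp (q_comp h g) f).
Proof.
apply: q_eq_graph => m z /q_of_relP [y [/q_of_relP [x [h1 h2]] h3]].
by apply/q_of_relP; exists x; split=> //; apply/q_of_relP; exists y.
Qed.

End GradedModules.

(* Categories whose sets of morphisms are presented as setoids: [mor_eq] is the
   equality of morphisms. *)
Record category := Category {
  cat_ob :> Type;
  mor : cat_ob -> cat_ob -> Type;
  mor_eq : forall X Y, mor X Y -> mor X Y -> Prop;
  mor_id : forall X, mor X X;
  mor_comp : forall X Y Z, mor Y Z -> mor X Y -> mor X Z;
  mor_eq_refl : forall X Y (f : mor X Y), mor_eq f f;
  mor_eq_sym : forall X Y (f g : mor X Y), mor_eq f g -> mor_eq g f;
  mor_eq_trans : forall X Y (f g h : mor X Y), mor_eq f g -> mor_eq g h -> mor_eq f h;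
  mor_comp_eq : forall X Y Z (g g' : mor Y Z) (f f' : mor X Y),
    mor_eq g g' -> mor_eq f f' -> mor_eq (mor_comp g f) (mor_comp g' f');
  mor_comp_id : forall X Y (f : mor X Y), mor_eq (mor_comp f (mor_id X)) f;
  mor_id_comp : forall X Y (f : mor X Y), mor_eq (mor_comp (mor_id Y) f) f;
  mor_compA : forall W X Y Z (h : mor Y Z) (g : mor X Y) (f : mor W X),
    mor_eq (mor_comp h (mor_comp g f)) (mor_comp (mor_comp h g) f)
}.

Definition monomorphism (C : category) (X Y : C) (i : mor X Y) : Prop :=
  forall (W : C) (u v : mor W X), mor_eq (mor_comp i u) (mor_comp i v) -> mor_eq u v.

Definition epimorphism (C : category) (X Y : C) (p : mor X Y) : Prop :=
  forall (Z : C) (u v : mor Y Z), mor_eq (mor_comp u p) (mor_comp v p) -> mor_eq u v.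

Definition projective_object (C : category) (P : C) : Prop :=
  forall (X Y : C) (p : mor X Y) (f : mor P Y), epimorphism p ->
    exists g : mor P X, mor_eq (mor_comp p g) f.

(* The quotient category Gr B / Fdim B. *)
Definition QGr (k : fieldType) (r : nat) : category :=
  @Category (grMod k r) (@qHom k r) (@q_eq k r) (@q_id k r) (@q_comp k r)
    (@q_eq_refl k r) (@q_eq_sym k r) (@q_eq_trans k r) (@q_comp_eq k r)
    (@q_comp1 k r) (@q_1comp k r) (@q_compA k r).

(* The objects of QGr B are those of Gr B: the image of a graded module in QGr B
   is that module. *)
Definition strO (k : fieldType) (r : nat) : QGr k r := regMod k r.

(* Main.v *)
From HB Require Import structures.
Require Import Defs.
From mathcomp Require Import all_boot all_algebra.
From mathcomp Require Import finmap boolp classical_sets monalg.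

(** Up to Fdim, a subobject S of O is a graded left ideal L of B, and L is free
    up to Fdim, because multiplication by x on the right destroys the relation
    y^(r+1) = 0.

    A word of more than r letters vanishes in B or contains the letter x, so
    L and the left ideal generated by the part V of L lying in xB agree up to
    Fdim.  The left ideal BV is free on any minimal homogeneous generating set
    chosen in V.  Indeed, let strip_a be the k-linear endomorphism of B that
    deletes the first letter of the reduced words beginning with a and kills
    the other ones.  It commutes with right multiplication by v in xB as long
    as it is applied to elements of positive degree (strip_mul): a product of
    reduced words u and xw is always reduced, so nothing is lost at the
    junction.  Now consider generators of degree at most that of v, and a
    relation expressing bv through them, with b homogeneous and nonzero.
    Stripping letters from the relation shortens b, as well as the coefficients
    of the generators, until b is a scalar; then v itself was redundant
    (pivot_free).

    A morphism f from S to Y is to be lifted along an epimorphism p from X to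
    Y.  Composing the inverse of the inclusion of S in O with f and with the
    inverse of p gives a graded B-linear correspondence H from B to X, whose
    domain agrees with L up to Fdim because the cokernel of p is in Fdim.  By
    freeness H contains the graph of a B-linear map defined on a submodule of
    its domain that agrees with the domain up to Fdim (graded_rel_section): the
    values on a basis may be chosen at will.  Instead of a basis, the proof
    uses a maximal partial map obtained from the lemma of Zorn, under a
    condition which forces generators to be added by increasing degree.
    Restricting that map to S gives the lift (qHom_lift); two values of the
    correspondence at the same element of S have images in Y that differ by
    torsion, since the kernel of the inclusion of S in O is in Fdim. *)

Set Implicit Arguments.
Unset Strict Implicit.
Unset Printing Implicit Defensive.
Import GRing.Theory.
Local Open Scope ring_scope.

(** * Stripping the first letter in B *)

Lemma prefix_nseq_cat (n : nat) (u v : seq bool) :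
  prefix (nseq n true) (u ++ false :: v) = prefix (nseq n true) u.
Proof. by elim: u n => [|a u IH] [|n] //=; rewrite IH. Qed.

(** A run of y's cannot straddle a letter x. Freeness over B of what lies in xB
    comes down to this. *)
Lemma infix_nseq_cat (n : nat) (u v : seq bool) :
  infix (nseq n.+1 true) (u ++ false :: v) =
  infix (nseq n.+1 true) u || infix (nseq n.+1 true) v.
Proof.
elim: u => [//|a u IH]; rewrite cat_cons !infix_consl -cat_cons.
by rewrite prefix_nseq_cat IH orbA.
Qed.

Lemma malgU_scale (k : fieldType) (c : k) (w : {fmonom bool}) :
  << c *g w >> = c *: << w >> :> freeAlg k.
Proof.
apply/malgP => v; rewrite mcoeffZ 2!mcoeffU; case: (w == v).
  by rewrite !mulr1n mulr1.
by rewrite !mulr0n mulr0.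
Qed.

Section Strip.
Variables (k : fieldType) (r : nat).
Local Notation B := (B k r).
Local Notation word := (@word k r).

Definition reduced (w : seq bool) : bool := ~~ infix (nseq r.+1 true) w.

Lemma word_nseq n : word (nseq n true) = toB r (freeY k ^+ n).
Proof.
elim: n => [|n IH]; first by rewrite expr0 rmorph1 word_nil.
rewrite -[nseq _ _]/([:: true] ++ nseq n true) word_cat IH exprS [RHS]toBM.
congr (_ * _).
rewrite /Defs.word /freeY; congr (toB r << _ >>); apply: val_inj => /=.
by rewrite fmU.
Qed.

Lemma freeY_relIdeal : freeY k ^+ r.+1 \in relIdeal k r.
Proof. by apply/asboolP; exists [:: (1, 1)]; rewrite big_seq1 mul1r mulr1. Qed.

Lemma word_unreduced w : ~~ reduced w -> word w = 0.
Proof.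
rewrite negbK => /infixP [u [v ->]]; rewrite !word_cat word_nseq.
have -> : toB r (freeY k ^+ r.+1) = 0 by apply/lquot_proj_eq0/freeY_relIdeal.
by rewrite mul0r mulr0.
Qed.

(** Unreduced words are sent to 0 so that the linear extension vanishes on the
    relations: bare deletion would send y^(r+1) to the nonzero element y^r. *)
Definition strip_word (a : bool) (w : seq bool) : B :=
  if w is b :: v then if reduced w && (b == a) then word v else 0 else 0.

Definition strip_free (a : bool) : freeAlg k -> B :=
  mmap (in_alg B) (fun w : {fmonom bool} => strip_word a w).
HB.instance Definition _ a := GRing.Additive.on (strip_free a).

Definition strip (a : bool) (b : B) : B := strip_free a (repr b).

Lemma strip_free0 a p : p \in relIdeal k r -> strip_free a p = 0.
Proof.
move=> /asboolP [s ->]; rewrite raddf_sum big1 // => -[u v] _ /=.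
have [y ey] : exists y : {fmonom bool}, freeY k ^+ r.+1 = << y >> /\
    fmonom_val y = nseq r.+1 true.
  elim: r.+1 => [|n [w [IH e]]]; first by exists mone; rewrite expr0 fm1.
  exists (mmul (fmu true) w); rewrite exprS IH malgM_def fgmulUU mulr1; split=> //.
  by rewrite fmM e fmU.
rewrite ey.1 (monalgE u) (monalgE v) mul3_sum raddf_sum big1 // => i _.
rewrite raddf_sum big1 // => j _ /=.
rewrite !malgM_def !fgmulUU /strip_free mmapU /=.
rewrite /strip_word; case E: (fmonom_val _) => [|b w]; first by rewrite mulr0.
have -> : reduced (b :: w) = false; last by rewrite mulr0.
by apply/negbF; rewrite -E !fmM ey.2 -catA infix_infix.
Qed.

Lemma strip_toB a p : strip a (toB r p) = strip_free a p.
Proof.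
apply/eqP; rewrite -subr_eq0 /strip -raddfB; apply/eqP/strip_free0.
by apply/toBP; rewrite toBK.
Qed.

Lemma stripD a b c : strip a (b + c) = strip a b + strip a c.
Proof. by rewrite -(toBK b) -(toBK c) -raddfD !strip_toB raddfD. Qed.

Lemma strip0 a : strip a 0 = 0.
Proof. by rewrite -[0 in LHS](raddf0 (toB r)) strip_toB raddf0. Qed.

Lemma strip_sum a (I : Type) (s : seq I) (F : I -> B) :
  strip a (\sum_(i <- s) F i) = \sum_(i <- s) strip a (F i).
Proof.
by elim: s => [|i s IH]; rewrite ?big_nil ?strip0 // !big_cons stripD IH.
Qed.

Lemma stripZ a (c : k) (w : seq bool) :
  strip a (c *: word w) = c *: strip_word a w.
Proof.
by rewrite /Defs.word -toBZ strip_toB /strip_free -malgU_scale mmapU /= mulr_algl.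
Qed.

Lemma B_deg_span n (b : B) : B_deg n b ->
  exists (s : seq (seq bool)) (c : seq bool -> k),
    b = \sum_(w <- s) c w *: word w /\ forall w, w \in s -> (size w)%:Z = n.
Proof.
move=> [p [-> hp]]; exists [seq fmonom_val w | w <- enum_fset (msupp p)].
exists (fun w => p@_(FMonom w)); split; last first.
  by move=> _ /mapP [w wp ->]; exact: hp.
rewrite big_map {1}(monalgE p) raddf_sum.
by apply: eq_bigr => w _; rewrite /Defs.word fmK -toBZ -malgU_scale.
Qed.

Lemma B_degZ n (c : k) (b : B) : B_deg n b -> B_deg n (c *: b).
Proof.
by move=> h; rewrite -mulr_algl -[n]add0r; apply: B_degM h; apply: algA_deg.
Qed.

Lemma B_deg_sum n (I : eqType) (s : seq I) (F : I -> B) :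
  (forall i, i \in s -> B_deg n (F i)) -> B_deg n (\sum_(i <- s) F i).
Proof.
move=> h; rewrite big_seq; apply: (big_ind (@B_deg k r n)) h.
- exact: grading0 (B_grading k r) n.
- by move=> u v; apply: gradingD (B_grading k r) _ _ _.
Qed.

Lemma B_deg_lt0 (n : nat) (b : B) : B_deg (Negz n) b -> b = 0.
Proof.
move=> /B_deg_span [s [c [-> h]]]; rewrite big_seq big1 // => w /h //.
Qed.

Lemma B_deg0 (b : B) : B_deg 0 b -> exists c : k, b = c%:A.
Proof.
move=> /B_deg_span [s [c [-> h]]]; exists (\sum_(w <- s) c w).
rewrite scaler_suml big_seq [RHS]big_seq; apply: eq_bigr => w /h.
by case: w => // _; congr (_ *: _); apply: word_nil.
Qed.

Lemma strip_deg a (n : nat) (b : B) : B_deg n.+1%:Z b -> B_deg n (strip a b).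
Proof.
move=> /B_deg_span [s [c [-> h]]]; rewrite strip_sum; apply: B_deg_sum => w /h.
rewrite stripZ => -[]; case: w => [//|b' v] /= [<-]; apply: B_degZ.
by case: ifP => _; [apply: word_deg | apply: grading0 (B_grading k r) _].
Qed.

Lemma strip_decomp (n : nat) (b : B) : B_deg n.+1%:Z b ->
  b = word [:: false] * strip false b + word [:: true] * strip true b.
Proof.
move=> /B_deg_span [s [c [-> h]]]; rewrite !strip_sum !mulr_sumr -big_split /=.
rewrite big_seq [RHS]big_seq; apply: eq_bigr => w /h.
case: w => // a v _; rewrite !stripZ -!scalerAr -scalerDr; congr (_ *: _).
rewrite /strip_word; case: (boolP (reduced (a :: v))) => [_|/word_unreduced ->].
  by case: a => /=; rewrite mulr0 -word_cat ?add0r ?addr0.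
by rewrite /= !mulr0 addr0.
Qed.

(** Deleting the first letter of a word u of positive length commutes with
    multiplication by xw on the right: since u x w is reduced exactly when u
    and w are, the deletion cannot turn a zero product into a nonzero one.
    With y in place of x this fails: y * y^r = 0 but y^r is not 0. *)
Lemma strip_mul a (n : nat) (b v : B) : B_deg n.+1%:Z b ->
  strip a (b * (word [:: false] * v)) = strip a b * (word [:: false] * v).
Proof.
move=> /B_deg_span [s [c [-> h]]]; have [t [d ->]] := B_span v.
rewrite mulr_sumr mulr_suml !strip_sum mulr_suml big_seq [RHS]big_seq.
apply: eq_bigr => w /h; case: w => // a' w _.
rewrite !mulr_sumr strip_sum; apply: eq_bigr => u _.
rewrite mulr_algl -!scalerAr -!scalerAl -!word_cat stripZ scalerA.
rewrite !stripZ -scalerA -scalerAl; congr (_ *: (_ *: _)).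
rewrite /= -cat_cons /reduced infix_nseq_cat negb_or -!/(reduced _).
case: (boolP (reduced (a' :: w))) => _ /=; last by rewrite mul0r.
case: (boolP (reduced u)) => [_|/word_unreduced e] /=.
  by case: eqP => _; rewrite ?mul0r // -word_cat.
by rewrite -[false :: u]/([:: false] ++ u) word_cat e !mulr0.
Qed.

End Strip.

(** * Graded linear correspondences from B to a module *)

Section Lifting.
Variables (k : fieldType) (r : nat).
Local Notation B := (B k r).
Local Notation word := (@word k r).
Local Notation bcpt := (@cpt k r (regMod k r)).
Local Notation X := (word [:: false]).

Lemma cptZ_homog (M : grMod k r) (b : B) d (m : M) n :
  gm_deg d m -> cpt (b *: m) n = (bcpt b (n - d) : B) *: m.
Proof.
move=> Dm; have [s [us s0 eb]] := gcomp_sum (gm_grading (regMod k r)) b.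
have E : cpt (b *: m) =1 (fun n => (bcpt b (n - d) : B) *: m); last exact: E.
apply: (gcompE (gm_grading M) (s := [seq i + d | i <- s])).
- by rewrite map_inj_uniq; [exact: us | apply: addIr].
- move=> i; rewrite -[X in gm_deg X](subrK d).
  by apply: gm_degZ => //; apply: (gcomp_deg (gm_grading (regMod k r))).
- move=> i si; rewrite /cpt s0 ?scale0r //; apply: contra si => si.
  by apply/mapP; exists (i - d); rewrite ?subrK.
rewrite big_map [X in X *: _ = _]eb scaler_suml; apply: eq_bigr => i _.
by rewrite /cpt addrK.
Qed.

(** A graded submodule of the product of B and M, or the empty relation: leaving
    0 out of the axioms makes them stable under unions of arbitrary chains, the
    empty chain included. *)
Record graded_rel (M : grMod k r) (G : B -> M -> Prop) : Prop := GRel {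
  graded_rel_lin : forall (b : B) z m z' m',
    G z m -> G z' m' -> G (b * z + z') (b *: m + m');
  graded_rel_cpt : forall z m n, G z m -> G (bcpt z n) (cpt m n)
}.

Section GrelTheory.
Variables (M : grMod k r) (G : B -> M -> Prop) (hG : graded_rel G) (G0 : G 0 0).

Lemma graded_relZ (b : B) z m : G z m -> G (b * z) (b *: m).
Proof. by move=> h; have := graded_rel_lin hG b h G0; rewrite !addr0. Qed.
Lemma graded_relD z m z' m' : G z m -> G z' m' -> G (z + z') (m + m').
Proof. by move=> h h'; have := graded_rel_lin hG 1 h h'; rewrite mul1r scale1r. Qed.
Lemma graded_rel_dom_sum (I : eqType) (s : seq I) (F : I -> B) :
  (forall i, i \in s -> exists m, G (F i) m) -> exists m, G (\sum_(i <- s) F i) m.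
Proof.
move=> h; rewrite big_seq; apply: (big_ind (fun z => exists m, G z m)) h.
  by exists 0.
by move=> u v [m hm] [m' hm']; exists (m + m'); apply: graded_relD.
Qed.
End GrelTheory.

Lemma bcpt_homog n (b : B) : B_deg n b -> bcpt b n = b.
Proof.
by move=> Db; rewrite /cpt (gcomp_homog (gm_grading (regMod k r)) n (Db : @gm_deg k r (regMod k r) n b)) eqxx.
Qed.

Lemma bcpt_deg n (b : B) : B_deg n (bcpt b n).
Proof. exact: (gcomp_deg (gm_grading (regMod k r))). Qed.

(** * A maximal partial map inside a correspondence *)

Section Maximal.
Variables (M : grMod k r) (H : B -> M -> Prop) (hH : graded_rel H) (H0 : H 0 0).

Definition pivot (d : int) (v : B) (m : M) : Prop :=
  [/\ B_deg d v, gm_deg d m, H v m & exists u, v = X * u].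

Definition domain (A : set (B * M)) (z : B) : Prop := exists m, A (z, m).

Definition strip_stable (A : set (B * M)) (d : nat) : Prop :=
  forall a (n : nat) z, (d <= n)%N -> B_deg n.+1%:Z z ->
    domain A z -> domain A (strip a z).

(** A partial map inside H whose domain has been filled by increasing degree:
    in each degree d, either the pivots of degree d have all been added, or
    only generators of degree at most d have been used, which is recorded in the
    form needed later, stability under stripping above degree d. Stating this as an alternative for
    each d makes the condition pass to unions of chains. *)
Record admissible (A : set (B * M)) : Prop := Admissible {
  adm_graded_rel : graded_rel (fun z m => A (z, m));
  adm_sub : forall z m, A (z, m) -> H z m;
  adm_fun : forall m, A (0, m) -> m = 0;
  adm_deg : forall d : nat,
    (forall v m, pivot d v m -> domain A v) \/ strip_stable A d
}.

(** For a given degree d, either one member of the chain already contains all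
    the pivots of degree d, or all members are stable under stripping. *)
Lemma admissible_bigcup (F : set (set (B * M))) :
  (F `<=` admissible)%classic -> total_on F subset ->
  admissible (\bigcup_(A in F) A)%classic.
Proof.
move=> Fadm Ftot; split.
- split.
    move=> b z m z' m' [A FA Az] [A' FA' Az'].
    have [C [FC AC AC']] : exists C, [/\ F C, subset A C & subset A' C].
      by case: (Ftot _ _ FA FA') => [h|h]; [exists A' | exists A]; split.
    exists C => //; apply: (graded_rel_lin (adm_graded_rel (Fadm _ FC))).
      exact: AC.
    exact: AC'.
  by move=> z m n [A FA Az]; exists A => //; apply: (graded_rel_cpt (adm_graded_rel (Fadm _ FA))).
- by move=> z m [A FA]; apply: adm_sub; apply: Fadm.
- by move=> m [A FA]; apply: adm_fun; apply: Fadm.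
move=> d.
have [[A FA hA]|h] := EM (exists2 A, F A & forall v m, pivot d v m -> domain A v).
  by left=> v m /hA [x Ax]; exists x, A.
right=> a n z dn Dz [x [A FA Az]].
case: (adm_deg (Fadm _ FA) d) => [hA|hA]; first by case: h; exists A.
have [y Ay] := hA a n z dn Dz (ex_intro _ x Az).
by exists y, A.
Qed.

Lemma admissible0 : admissible [set (0, 0)]%classic.
Proof.
split.
- split=> [b z m z' m' [-> ->] [-> ->]|z m n [-> ->]] /=.
    by rewrite mulr0 scaler0 !addr0.
  by rewrite /cpt !gcomp0.
- by move=> z m [-> ->].
- by move=> m [].
by move=> d; right=> a n z _ _ [m [-> _]]; exists 0; rewrite strip0.
Qed.

(** Extension of an admissible map by one value: d is the least degree in which
    a pivot is missing from the domain, and v is such a pivot. *)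
Section Extension.
Variables (A : set (B * M)) (hA : admissible A) (A0 : A (0, 0)).
Variables (d : nat) (v : B) (x : M).
Hypotheses (pv : pivot d v x) (nv : ~ domain A v) (sA : strip_stable A d).
Hypothesis lowA : forall (d' : nat) v' m, (d' < d)%N -> pivot d' v' m -> domain A v'.

Let gA : graded_rel (fun z m => A (z, m)) := adm_graded_rel hA.

Lemma pivot_strip a (n : nat) (b : B) :
  B_deg n.+1%:Z b -> strip a (b * v) = strip a b * v.
Proof. by case: pv => _ _ _ [u ->]; apply: strip_mul. Qed.

(** By induction on the degree of b: stripping bv stays inside the domain and
    shortens b. In degree 0, b is a scalar, and a nonzero scalar would put v in
    the domain. *)
Lemma pivot_free_homog (e : nat) (b : B) : B_deg e b -> domain A (b * v) -> b = 0.
Proof.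
have dZ (c z : B) : domain A z -> domain A (c * z).
  by move=> [m h]; exists (c *: m); apply: (graded_relZ gA A0).
elim: e b => [|e IH] b Db hb.
  have [c ec] := B_deg0 Db; case: (eqVneq c 0) ec hb => [-> -> _|c0 -> hb].
    exact: scale0r.
  case: nv; have := dZ (c^-1)%:A _ hb.
  by rewrite !mulr_algl scalerA mulVf // scale1r.
have sb a : strip a b = 0.
  apply: IH; first exact: strip_deg.
  rewrite -(pivot_strip _ Db). apply: (sA a (leq_addr e d) _ hb).
  have -> : (d + e).+1%:Z = e.+1%:Z + d%:Z by rewrite -PoszD addnC.
  by case: pv => Dv _ _ _; apply: B_degM.
by rewrite (strip_decomp Db) !sb !mulr0 addr0.
Qed.

(** The sum of the domain and of Bv is therefore direct and Bv is free, so any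
    value may be prescribed at v. *)
Lemma pivot_free (b : B) : domain A (b * v) -> b = 0.
Proof.
move=> [m h]; apply: (@cpt_eq0 _ _ (regMod k r)) => -[e|e]; last first.
  by apply: B_deg_lt0; apply: bcpt_deg.
apply: pivot_free_homog (bcpt_deg _ _) _.
have := graded_rel_cpt gA (e%:Z + d%:Z) h; case: pv => Dv _ _ _.
rewrite (@cptZ_homog (regMod k r) b d v) // addrK => h'.
by exists (cpt m (e%:Z + d%:Z)).
Qed.

Definition extend : set (B * M) := fun zm =>
  exists z m b, [/\ A (z, m), zm.1 = z + b * v & zm.2 = m + b *: x].

Lemma extend_sub : (A `<=` extend)%classic.
Proof. by move=> [z m] h; exists z, m, 0; rewrite mul0r scale0r !addr0. Qed.

Lemma extend_pivot : extend (v, x).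
Proof. by exists 0, 0, 1; rewrite mul1r scale1r !add0r. Qed.

Lemma extend_cpt z (b : B) n : cpt (z + b * v : regMod k r) n = bcpt z n + bcpt b (n - d%:Z) * v.
Proof.
case: pv => Dv _ _ _.
rewrite /cpt gcompD; congr (_ + _).
exact: (@cptZ_homog (regMod k r) b d v).
Qed.

Lemma extend_admissible : admissible extend.
Proof.
have [Dv Dx Hvx _] := pv; split.
- split.
    move=> c _ _ _ _ [z [m [b [h /= -> ->]]]] [z' [m' [b' [h' /= -> ->]]]].
    exists (c * z + z'), (c *: m + m'), (c * b + b'); split.
    + exact: (graded_rel_lin gA).
    + by rewrite /= mulrDr mulrDl mulrA addrACA.
    + by rewrite /= scalerDr scalerDl scalerA addrACA.
  move=> _ _ n [z [m [b [h /= -> ->]]]].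
  exists (bcpt z n), (cpt m n), (bcpt b (n - d%:Z)); split => /=.
  + exact: (graded_rel_cpt gA).
  + exact: extend_cpt.
  + by rewrite -cptZ_homog // /cpt gcompD.
- move=> _ _ [z [m [b [h /= -> ->]]]].
  apply: (graded_relD hH); first exact: (adm_sub hA).
  exact: (graded_relZ hH).
- move=> _ [z [m [b [h /= e ->]]]].
  have b0 : b = 0.
    apply: pivot_free; exists (- m).
    have := graded_relZ gA A0 (-1) h; rewrite mulN1r scaleN1r.
    by move/esym/eqP: e; rewrite addr_eq0 => /eqP ->; rewrite opprK.
  move: e; rewrite b0 mul0r scale0r !addr0 => e.
  by apply: (adm_fun hA); rewrite e.
move=> d'; case: (ltnP d' d) => [lt|le].
  by left=> v' m' /(lowA lt) [y Ay]; exists y; apply: extend_sub.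
right=> a n z d'n Dz [_ [z1 [m1 [b [h /= e _]]]]].
have ez : z = bcpt z1 n.+1%:Z + bcpt b (n.+1%:Z - d%:Z) * v.
  by rewrite -extend_cpt -e bcpt_homog.
have dn : (d <= n)%N := leq_trans le d'n.
have Db : B_deg (n - d).+1%:Z (bcpt b (n.+1%:Z - d%:Z)).
  by rewrite -subSn // -subzn ?(leq_trans dn) //; apply: bcpt_deg.
rewrite ez stripD (pivot_strip _ Db).
have [y hy] : domain A (strip a (bcpt z1 n.+1%:Z)).
  apply: sA dn (bcpt_deg _ _) _.
  by exists (cpt m1 n.+1%:Z); apply: (graded_rel_cpt gA).
by eexists; exists (strip a (bcpt z1 n.+1%:Z)), y, (strip a (bcpt b (n.+1%:Z - d%:Z))).
Qed.

End Extension.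

(** A pivot outside the domain of a maximal admissible map, taken of least
    degree, would allow an extension. *)
Lemma exists_graded_rel_fun : exists G : B -> M -> Prop,
  [/\ graded_rel G, forall z m, G z m -> H z m, forall m, G 0 m -> m = 0 &
      G 0 0 /\ forall v m d, pivot d v m -> exists m', G v m'].
Proof.
have [A [hA maxA]] := Zorn_bigcup admissible_bigcup.
have A0 : A (0, 0).
  apply: contrapT => nA; have [[z m] Az] : exists zm, A zm.
    apply: contrapT => eA; apply: (maxA _ _ admissible0); split.
      by move=> zm Azm; case: eA; exists zm.
    by move=> h; apply: nA; apply: h.
  apply: nA; have := graded_rel_lin (adm_graded_rel hA) (-1) Az Az.
  by rewrite mulN1r scaleN1r !addNr.
exists (fun z m => A (z, m)); split; [exact: adm_graded_rel | exact: adm_sub | exact: adm_fun |].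
split=> // v m [d|d]; last first.
  by case=> /B_deg_lt0 -> _ _ _; exists 0.
move=> pv; apply: contrapT => nv.
pose P (d : nat) := `[< exists v m, pivot d v m /\ ~ domain A v >].
have [|d0 /asboolP [v0 [m0 [pv0 nv0]]] d0min] := @ex_minnP P.
  by exists d; apply/asboolP; exists v, m.
have low (d' : nat) v' m' : (d' < d0)%N -> pivot d' v' m' -> domain A v'.
  move=> lt p'; apply: contrapT => n'; move: lt; rewrite ltnNge => /negP; apply.
  by apply: d0min; apply/asboolP; exists v', m'.
have sA : strip_stable A d0.
  by case: (adm_deg hA d0) => // h; case: nv0; apply: h pv0.
apply: maxA (extend_admissible hA A0 pv0 nv0 sA low); split; first exact: extend_sub.
by move/(_ _ (extend_pivot A0 v0 m0)) => h; apply: nv0; exists m0.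
Qed.

Lemma long_word_split (w : seq bool) : (r < size w)%N ->
  word w = 0 \/ exists u v, w = u ++ false :: v.
Proof.
move=> hw; case: (boolP (false \in w)) => [/splitPr [u v]|nw].
  by right; exists u, v.
left; apply: word_unreduced; rewrite negbK.
have -> : w = nseq (size w) true.
  by apply/all_pred1P/allP => -[] // h; rewrite h in nw.
by rewrite -(subnKC hw) nseqD prefix_infix.
Qed.

(** A correspondence from B has a B-linear section, up to torsion in its
    domain. A long word w is 0 or of the form u x v', and then w z is the sum of
    the multiples by u of the pivots x v' z_n, where z_n are the homogeneous
    components of z. *)
Lemma graded_rel_section : exists G : B -> M -> Prop,
  [/\ graded_rel G, G 0 0, forall z m, G z m -> H z m, forall m, G 0 m -> m = 0 &
      forall z m (w : seq bool), H z m -> (r < size w)%N ->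
        exists m', G (word w * z) m'].
Proof.
have [G [gG GH Gfun [G0 Gpiv]]] := exists_graded_rel_fun.
exists G; split=> // z m w hz /long_word_split [->|[u [v ->]]].
  by exists 0; rewrite mul0r.
have [s [_ _ ez]] := gcomp_sum (gm_grading (regMod k r)) z.
rewrite ez mulr_sumr; apply: (graded_rel_dom_sum gG G0) => i _.
have Hi := graded_relZ hH H0 (word (false :: v)) (graded_rel_cpt hH i hz).
have [|m' hm'] := Gpiv (word (false :: v) * bcpt z i)
    (word (false :: v) *: cpt m i) ((size v).+1%:Z + i).
  split=> //.
  - by apply: B_degM; [apply: word_deg | apply: bcpt_deg].
  - by apply: gm_degZ; [apply: word_deg | apply: gcomp_deg].
  - by exists (word v * bcpt z i); rewrite mulrA -word_cat.
exists (word u *: m'); have := graded_relZ gG G0 (word u) hm'.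
by rewrite mulrA -word_cat.
Qed.

End Maximal.
End Lifting.

(** * Monomorphisms and epimorphisms modulo torsion *)

Section Quotient.
Variables (k : fieldType) (r : nat).
Local Notation B := (B k r).
Local Notation word := (@word k r).

Definition torsion (M : grMod k r) (m : M) : Prop := evk (fun x => x = 0) m.

Lemma torsionB (M : grMod k r) (u v : M) : torsion u -> torsion v -> torsion (u - v).
Proof.
move=> [p hp] [q hq].
exists (maxn p q) => w; rewrite geq_max => /andP [pw qw].
by rewrite scalerBr hp // hq // subr0.
Qed.

Lemma torsion_evk (M : grMod k r) (m : M) : evk (@torsion M) m -> torsion m.
Proof. by move=> h; apply: evk_trans h _. Qed.

Lemma linear_qrel (M N : grMod k r) (h : {linear M -> N}) :
  (forall n m, gm_deg n m -> gm_deg n (h m)) -> is_qrel (fun m n => n = h m).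
Proof.
move=> hd; split.
- by rewrite linear0.
- by move=> b m _ m' _ -> ->; rewrite linearP.
- move=> m _ -> i; have [s [us s0 em]] := gcomp_sum (gm_grading M) m.
  move: i; apply: (gcompE (gm_grading N) us).
  + by move=> j; apply: hd; apply: gcomp_deg.
  + by move=> j /s0; rewrite /cpt => ->; rewrite linear0.
  by rewrite {1}em linear_sum.
- by move=> m; exists 0%N => w _; exists (h (word w *: m)).
- by move=> n ->; rewrite linear0; exists 0%N => w _; rewrite scaler0.
Qed.

Section KerIm.
Variables (M N : grMod k r) (f : qHom M N).
Let gf := q_graph_qrel f.

Lemma ker_closed : GRing.submod_closed (fun m : M => `[< q_graph f m 0 >]).
Proof.
split; first by apply/asboolP; apply: qrel0.
move=> b m m' /asboolP h /asboolP h'; apply/asboolP.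
by have := qrelP gf b h h'; rewrite scaler0 addr0.
Qed.
Lemma ker_homog m : m \in Submodule ker_closed ->
  forall i, cpt m i \in Submodule ker_closed.
Proof.
move=> /asboolP h i; apply/asboolP; have := qrel_cpt gf h i.
by rewrite {2}/cpt gcomp0.
Qed.
Definition q_ker : grSub M := GrSub ker_homog.

Lemma im_closed : GRing.submod_closed (fun n : N => `[< exists m, q_graph f m n >]).
Proof.
split; first by apply/asboolP; exists 0; apply: qrel0.
move=> b n n' /asboolP [m h] /asboolP [m' h']; apply/asboolP.
by exists (b *: m + m'); apply: qrelP.
Qed.
Lemma im_homog n : n \in Submodule im_closed ->
  forall i, cpt n i \in Submodule im_closed.
Proof.
move=> /asboolP [m h] i; apply/asboolP; exists (cpt m i); exact: qrel_cpt.
Qed.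
Definition q_im : grSub N := GrSub im_homog.

(** The inclusion of the kernel and the zero map have the same composite with a
    monomorphism, hence are equal in the quotient category. *)
Lemma mono_ker : @monomorphism (QGr k r) M N f ->
  forall m, q_graph f m 0 -> torsion m.
Proof.
move=> mf m hm.
have ru : is_qrel (fun (x : gr_sub q_ker) (y : M) => y = val x).
  exact: (@linear_qrel (gr_sub q_ker) M val).
have rv : is_qrel (fun (x : gr_sub q_ker) (y : M) => y = 0).
  apply: (@linear_qrel (gr_sub q_ker) M \0) => n x _.
  exact: grading0 (gm_grading M) n.
have /(mf (gr_sub q_ker) (q_of_rel ru)) : mor_eq (c := QGr k r)
    (mor_comp (c := QGr k r) f (q_of_rel ru)) (mor_comp (c := QGr k r) f (q_of_rel rv)).
  apply/q_eqP => x a b /q_of_relP [y [/q_of_relP -> ha]].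
  move=> /q_of_relP [z [/q_of_relP -> hb]].
  apply: (qrel_ind gf); apply: (qrel_uniq gf _ hb).
  have /asboolP h := sub_valP x.
  by have := qrelB gf ha h; rewrite subrr subr0.
have km : m \in submod_pred q_ker by apply/asboolP.
move/q_eqP => /(_ (SubOf km) m 0); rewrite subr0; apply.
  by apply/q_of_relP.
by apply/q_of_relP.
Qed.

(** The projection onto the cokernel and the zero map have the same composite
    with an epimorphism, hence are equal in the quotient category. *)
Lemma epi_im : @epimorphism (QGr k r) M N f ->
  forall n, evk (fun y => exists m, q_graph f m y) n.
Proof.
move=> ef n.
have ru : is_qrel (fun (x : N) (y : gr_quot q_im) => y = lquot_proj q_im x).
  by apply: (@linear_qrel N (gr_quot q_im) (lquot_proj q_im)) => i x; exists x.
have rv : is_qrel (fun (x : N) (y : gr_quot q_im) => y = 0).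
  apply: (@linear_qrel N (gr_quot q_im) \0) => i x _.
  exact: grading0 (gm_grading (gr_quot q_im)) i.
have /(ef (gr_quot q_im) (q_of_rel ru)) : mor_eq (c := QGr k r)
    (mor_comp (c := QGr k r) (q_of_rel ru) f) (mor_comp (c := QGr k r) (q_of_rel rv) f).
  apply/q_eqP => x a b /q_of_relP [y [hy /q_of_relP ->]].
  move=> /q_of_relP [z [_ /q_of_relP ->]]; rewrite subr0.
  have -> : lquot_proj q_im y = 0.
    by apply/lquot_proj_eq0/asboolP; exists x.
  by exists 0%N => w _; rewrite scaler0.
move/q_eqP => /(_ n (lquot_proj q_im n) 0); rewrite subr0 => h.
have [p hp] : torsion (lquot_proj q_im n : gr_quot q_im).
  by apply: h; apply/q_of_relP.
exists p => w /hp; rewrite -linearZ => /lquot_proj_eq0 /asboolP //.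
Qed.
End KerIm.
End Quotient.

(** * Lifting along an epimorphism *)

Section Lift.
Variables (k : fieldType) (r : nat) (S X Y : grMod k r).
Variables (i : qHom S (regMod k r)) (p : qHom X Y) (f : qHom S Y).
Hypothesis ker_i : forall s, q_graph i s 0 -> torsion s.
Hypothesis im_p : forall y, evk (fun y => exists x, q_graph p x y) y.

Let gi := q_graph_qrel i.
Let gp := q_graph_qrel p.
Let gf := q_graph_qrel f.

(** The composite of the inverse of i, of f and of the inverse of p. *)
Definition corr (b : B k r) (x : X) : Prop :=
  exists s y, [/\ q_graph i s b, q_graph f s y & q_graph p x y].

Lemma corr_graded_rel : graded_rel corr.
Proof.
split.
  move=> c b x b' x' [s [y [h1 h2 h3]]] [s' [y' [h1' h2' h3']]].
  exists (c *: s + s'), (c *: y + y'); split; last 2 first.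
  - exact: (qrelP gf).
  - exact: (qrelP gp).
  exact: (qrelP gi).
move=> b x n [s [y [h1 h2 h3]]]; exists (cpt s n), (cpt y n).
by split; [exact: (qrel_cpt gi) | exact: (qrel_cpt gf) | exact: (qrel_cpt gp)].
Qed.

Lemma corr0 : corr 0 0.
Proof. by exists 0, 0; split; [exact: (qrel0 gi) | exact: (qrel0 gf) | exact: (qrel0 gp)]. Qed.

(** Up to torsion, y and y' are the values of f at two elements of S with the
    same image b in O, and these differ by torsion since the kernel of i is
    torsion. *)
Lemma corr_graph s b x y y' : q_graph i s b -> corr b x ->
  q_graph f s y -> q_graph p x y' -> torsion (y' - y).
Proof.
move=> hi [t [z [hit hft hpx]]] hf hp.
rewrite -(subrK z y') -addrA -[z - y]opprB.
apply: torsionB.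
  exact: (qrel_ind gp (qrel_uniq gp hp hpx)).
apply: torsion_evk; have [n hn] : torsion (s - t).
  by apply: ker_i; have := qrelB gi hi hit; rewrite subrr.
exists n => w /hn e; apply: (qrel_ind gf).
by rewrite -e; apply: (qrelZ gf); apply: (qrelB gf).
Qed.

(** The lift is the composite of i with a section of the correspondence. *)
Lemma qHom_lift : exists g : qHom S X, q_eq (q_comp p g) f.
Proof.
have [G [gG G0 GH Gfun Gdom]] := graded_rel_section corr_graded_rel corr0.
pose R (s : S) (x : X) := exists b : B k r, q_graph i s b /\ G b x.
have gR : is_qrel R.
  split.
  - by exists 0; split=> //; apply: (qrel0 gi).
  - move=> c s x s' x' [b [h1 h2]] [b' [h1' h2']]; exists (c * b + b'); split.
      exact: (qrelP gi).
    exact: (graded_rel_lin gG).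
  - move=> s x [b [h1 h2]] n; exists (cpt (b : regMod k r) n); split.
      exact: (qrel_cpt gi).
    exact: (graded_rel_cpt gG).
  - move=> s.
    apply: (evk_trans (evk_and (qrel_dom gi s) (qrel_dom gf s))) => s1.
    move=> [[b hb] [y hy]].
    have : evk (fun t => exists b x, q_graph i t b /\ corr b x) s1.
      have [n hn] := im_p y; exists n => w /hn [x hx].
      exists (word k r w * b), x; have hwb := qrelZ gi (word k r w) hb.
      split; first exact: hwb.
      exists (word k r w *: s1), (word k r w *: y); split=> //.
      exact: (qrelZ gf).
    move/evk_trans; apply => s2 [b2 [x2 [hb2 hx2]]].
    exists r.+1 => w /(Gdom _ _ _ hx2) [x' hx']; exists x', (word k r w * b2).
    by split=> //; apply: (qrelZ gi (word k r w) hb2).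
  move=> x [b [hb hx]]; have [n hn] := qrel_ind gi hb; exists n => w /hn e.
  by apply: Gfun; have := graded_relZ gG G0 (word k r w) hx; rewrite [_ * _]e.
exists (q_of_rel gR); apply/q_eqP => s u v /q_of_relP [x [/q_of_relP [b [hb hx]] hu]] hv.
exact: (corr_graph hb (GH _ _ hx) hv hu).
Qed.
End Lift.

(* B = k<x, y>/(y^(r+1)); S with the monomorphism i is a subobject of O. *)
Theorem proposition5p4 (k : fieldType) (r : nat) (hr : (1 <= r)%N)
  (S : QGr k r) (i : mor S (strO k r)) (hi : monomorphism i) :
  projective_object S.
Proof.
by move=> X Y p f ep; apply: (@qHom_lift k r S X Y i p f (mono_ker hi) (epi_im ep)).
Qed.
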